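(* Assume the standing setup below. Let $\rho_r>0$ and $\gamma_1>0$, set $\rho=\rho_r+\gamma_1$, and suppose (C1) $\|\mathcal{G}_{xm}(s)\|_{\mathcal{L}_1}b_{f,\Omega(\rho_r)}<\rho_r-\|\mathcal{H}_{xv}(s)\|_{\mathcal{L}_1}\|v\|_{\mathcal{L}_\infty}-\rho_\mathrm{in}$; (C2) $\|\mathcal{G}_{xm}(s)\|_{\mathcal{L}_1}L_{f,\Omega(\rho)}<1$; (C3) $\dfrac{\|\mathcal{H}_{xm}(s)\mathcal{C}(s)B^\dagger(sI_n-A_e)\|_{\mathcal{L}_1}}{1-\|\mathcal{G}_{xm}(s)\|_{\mathcal{L}_1}L_{f,\Omega(\rho)}}\gamma_0(T)<\gamma_1$. Then $\|x\|_{\mathcal{L}_\infty}\le\rho$, $\|u_a\|_{\mathcal{L}_\infty}\le\rho_{u_a}$, $\|x_\mathrm{r}-x\|_{\mathcal{L}_\infty}\le\gamma_1$ and $\|u_\mathrm{r}-u_a\|_{\mathcal{L}_\infty}\le\gamma_2$, where $\gamma_2\triangleq\|\mathcal{C}(s)\|_{\mathcal{L}_1}L_{f,\Omega(\rho)}\gamma_1+\|\mathcal{C}(s)B^\dagger(sI_n-A_e)\|_{\mathcal{L}_1}\gamma_0(T)$ and $\rho_{u_a}\triangleq\|\mathcal{C}(s)\|_{\mathcal{L}_1}b_{f,\Omega(\rho_r)}+\gamma_2$.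
   Context: Notation: $\|\cdot\|_\infty$ is the vector $\infty$-norm / induced matrix $\infty$-norm; $\|x\|_{\mathcal{L}_\infty}=\sup_{t\ge0}\|x(t)\|_\infty$; $\Omega(\rho)=\{z:\|z\|_\infty\le\rho\}$; $\mathfrak{L}$ is Laplace transform; $B^\dagger$ is the Moore–Penrose pseudo-inverse. For a stable proper transfer matrix $\mathcal{H}(s)$, $\|\mathcal{H}(s)\|_{\mathcal{L}_1}=\sup\{\|y\|_{\mathcal{L}_\infty}: y$ the zero-initial-state output for input $u$ with $\|u\|_{\mathcal{L}_\infty}\le1\}$. Standing setup: $A_m\in\mathbb{R}^{n\times n}$ Hurwitz, $B\in\mathbb{R}^{n\times m}$ full column rank, $B_v\in\mathbb{R}^{n\times m}$; $v$ bounded piecewise-continuous; $x_0\in\mathcal{X}_0$, $\mathcal{X}_0$ compact. Uncertainty $f:[0,\infty)\times\mathbb{R}^n\to\mathbb{R}^m$: for every compact $\mathcal{Z}$ there are constants with $|f_j(t,x)-f_j(\tau,z)|\le L_{f_j,\mathcal{Z}}\|x-z\|_\infty+l_{f_j,\mathcal{Z}}|t-\tau|$, $|f_j(t,x)|\le b_{f_j,\mathcal{Z}}$ for $x,z\in\mathcal{Z}$, $t,\tau\ge0$; $L_{f,\mathcal{Z}}=\max_jL_{f_j,\mathcal{Z}}$, $b_{f,\mathcal{Z}}=\max_jb_{f_j,\mathcal{Z}}$. Filter $\mathcal{C}(s)=\mathrm{diag}(k_f^j/(s+k_f^j))$, $k_f^j>0$. $\mathcal{H}_{xm}=(sI_n-A_m)^{-1}B$,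 $\mathcal{H}_{xv}=(sI_n-A_m)^{-1}B_v$, $\mathcal{G}_{xm}=\mathcal{H}_{xm}(I_m-\mathcal{C})$, $\rho_\mathrm{in}=\|s(sI_n-A_m)^{-1}\|_{\mathcal{L}_1}\max_{x_0\in\mathcal{X}_0}\|x_0\|_\infty$. Adaptive system: $\dot x=A_mx+B_vv+B(u_a+f(t,x))$, $x(0)=x_0$, with $\mathcal{L}_1$ adaptive controller: Hurwitz $A_e$; $B^\perp\in\mathbb{R}^{n\times(n-m)}$ with $(B^\perp)^\top B=0$, $\mathrm{rank}[B\ B^\perp]=n$; predictor $\dot{\hat x}=A_mx+B_vv+B(u_a+\hat\sigma_1)+B^\perp\hat\sigma_2+A_e\tilde x$, $\hat x(0)=x_0$, $\tilde x=\hat x-x$; sample time $T>0$, $\Phi(T)=A_e^{-1}(e^{A_eT}-I_n)$; adaptive law $[\hat\sigma_1(t);\hat\sigma_2(t)]=-[B\ B^\perp]^{-1}\Phi^{-1}(T)e^{A_eT}\tilde x(iT)$ for $t\in[iT,(i+1)T)$, $i\in\mathbb{Z}_+$; control law $u_a(s)=-\mathcal{C}(s)\mathfrak{L}[\hat\sigma_1(t)]$. Reference system: $\dot x_\mathrm{r}=A_mx_\mathrm{r}+B_vv+B(u_\mathrm{r}+f(t,x_\mathrm{r}))$, $x_\mathrm{r}(0)=x_0$, $u_\mathrm{r}(s)=-\mathcal{C}(s)\mathfrak{L}[f(t,x_\mathrm{r}(t))]$. All systems are assumed to have unique continuous solutions on $[0,\infty)$. $\bar\alpha_0(T)=\int_0^T\|e^{A_e(T-\tau)}B\|_\infty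 d\tau$, $\bar\alpha_1(T)=\max_{t\in[0,T]}\|e^{A_et}\|_\infty$, $\bar\alpha_2(T)=\max_{t\in[0,T]}\int_0^t\|e^{A_e(t-\tau)}\Phi^{-1}(T)e^{A_eT}\|_\infty d\tau$, and $\gamma_0(T)=b_{f,\Omega(\rho)}\bar\alpha_0(T)(\bar\alpha_1(T)+\bar\alpha_2(T)+1)$ with $\rho=\rho_r+\gamma_1$. *)

(* Defs.v *)
From HB Require Import structures.
From mathcomp Require Import all_boot all_order all_algebra.
From mathcomp Require Import all_classical all_reals all_analysis.
Import Order.TTheory GRing.Theory Num.Theory.
Import numFieldNormedType.Exports.

Set Implicit Arguments.
Unset Strict Implicit.
Unset Printing Implicit Defensive.

Local Open Scope classical_set_scope.
Local Open Scope ring_scope.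

Section L1Defs.
Variable R : realType.

(* signals: functions of time with values in column vectors (only t >= 0 matters) *)
Definition sgn (k : nat) := R -> 'cV[R]_k.

(* induced infinity-norm of a matrix (max row sum); for a column vector this
   is the vector infinity-norm max_i |x_i| *)
Definition inorm (a b : nat) (M : 'M[R]_(a, b)) : R :=
  \big[Num.max/0]_(i < a) \sum_(j < b) `|M i j|.

Definition expmx (k : nat) (A : 'M[R]_k) : 'M[R]_k :=
  \matrix_(i, j) limn (fun N : nat => \sum_(l < N) (A ^+ l) i j / (l`!)%:R).

Definition vint (k : nat) (f : R -> 'cV[R]_k) (a b : R) : 'cV[R]_k :=
  \col_i (\int[lebesgue_measure]_(x in `[a, b]) f x i 0).

(* zero-initial-state input/output map of the state-space system
   z' = A z + B u, y = C z + D u, i.e. of the transfer matrix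
   C (sI - A)^{-1} B + D :
   y(t) = C int_0^t e^{A(t-tau)} B u(tau) dtau + D u(t) *)
Definition lti (k p q : nat) (A : 'M[R]_k) (B : 'M[R]_(k, p))
  (C : 'M[R]_(q, k)) (D : 'M[R]_(q, p)) (u : sgn p) : sgn q :=
  fun t => C *m vint (fun tau => expmx ((t - tau) *: A) *m B *m u tau) 0 t
           + D *m u t.

Definition Linf (k : nat) (x : sgn k) : R :=
  sup [set inorm (x t) | t in [set t : R | 0 <= t]].

Definition unit_input (p : nat) (u : sgn p) : Prop :=
  (forall i, measurable_fun setT (fun t => u t i 0)) /\
  (forall t, 0 <= t -> inorm (u t) <= 1).

(* L1 norm of a (stable, proper) system given by its zero-initial-state
   input/output map: sup { ||y||_{L_infty} : ||u||_{L_infty} <= 1 } *)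
Definition L1norm (p q : nat) (F : sgn p -> sgn q) : R :=
  sup [set Linf (F u) | u in @unit_input p].

(* Hurwitz: every (complex) eigenvalue a + i b, with eigenvector x + i y,
   has negative real part *)
Definition hurwitz (k : nat) (A : 'M[R]_k) : Prop :=
  forall (a b : R) (x y : 'cV[R]_k), (x != 0) || (y != 0) ->
    A *m x = a *: x - b *: y -> A *m y = b *: x + a *: y -> a < 0.

Definition pw_cont_real (g : R -> R) : Prop :=
  forall b, 0 < b -> exists s : seq R,
    (forall t, 0 < t < b -> t \notin s -> {for t, continuous g}) /\
    (forall t, 0 <= t <= b -> cvg (g x @[x --> t^'+])) /\
    (forall t, 0 < t <= b -> cvg (g x @[x --> t^'-])).

Definition pw_cont (k : nat) (v : sgn k) : Prop :=
  forall i, pw_cont_real (fun t => v t i 0).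

Definition bounded_sig (k : nat) (v : sgn k) : Prop :=
  exists M, forall t, 0 <= t -> inorm (v t) <= M.

Definition Omega (k : nat) (rho : R) : set 'cV[R]_k :=
  [set z | inorm z <= rho].

Definition f_consts (n m : nat) (f : R -> 'cV[R]_n -> 'cV[R]_m)
  (Z : set 'cV[R]_n) (L l b : 'I_m -> R) : Prop :=
  (forall j t tau x z, 0 <= t -> 0 <= tau -> Z x -> Z z ->
     `|f t x j 0 - f tau z j 0| <= L j * inorm (x - z) + l j * `|t - tau|) /\
  (forall j t x, 0 <= t -> Z x -> `|f t x j 0| <= b j).

Definition maxj (m : nat) (c : 'I_m -> R) : R := \big[Num.max/0]_(j < m) c j.

(* filter C(s) = diag(k_f^j / (s + k_f^j)) *)
Definition Kf (m : nat) (kf : 'I_m -> R) : 'M[R]_m := diag_mx (\row_j kf j).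
Definition filt (m : nat) (kf : 'I_m -> R) : sgn m -> sgn m :=
  lti (- Kf kf) (Kf kf) 1 0.

(* Moore-Penrose pseudo-inverse of a full-column-rank matrix *)
Definition pinv (n m : nat) (B : 'M[R]_(n, m)) : 'M[R]_(m, n) :=
  invmx (B^T *m B) *m B^T.

Definition Hxm (n m : nat) (Am : 'M[R]_n) (B : 'M[R]_(n, m)) : sgn m -> sgn n :=
  lti Am B 1 0.

Definition Gxm (n m : nat) (Am : 'M[R]_n) (B : 'M[R]_(n, m)) (kf : 'I_m -> R)
  : sgn m -> sgn n :=
  fun u => Hxm Am B (fun t => u t - filt kf u t).

(* C(s) B^dagger (sI - A_e).  Realization used: since
   C(s) s = K (I - C(s)) with K = diag(k_f^j),
   C(s) B^+ (sI - A_e) = K B^+ - C(s) (K B^+ + B^+ A_e)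
                       = D + Cr (sI - Ar)^{-1} Br  with
   Ar = -K, Br = K (K B^+ + B^+ A_e), Cr = -I, D = K B^+. *)
Definition CBsAe (n m : nat) (B : 'M[R]_(n, m)) (Ae : 'M[R]_n)
  (kf : 'I_m -> R) : sgn n -> sgn m :=
  lti (- Kf kf) (Kf kf *m (Kf kf *m pinv B + pinv B *m Ae)) (- 1)
      (Kf kf *m pinv B).

Definition HxmCBsAe (n m : nat) (Am : 'M[R]_n) (B : 'M[R]_(n, m))
  (Ae : 'M[R]_n) (kf : 'I_m -> R) : sgn n -> sgn n :=
  fun u => Hxm Am B (CBsAe B Ae kf u).

(* s (sI - A_m)^{-1} = I + A_m (sI - A_m)^{-1} *)
Definition sHm (n : nat) (Am : 'M[R]_n) : sgn n -> sgn n := lti Am 1 Am 1.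

Definition PhiT (n : nat) (Ae : 'M[R]_n) (T : R) : 'M[R]_n :=
  invmx Ae *m (expmx (T *: Ae) - 1).

Definition alpha0 (n m : nat) (Ae : 'M[R]_n) (B : 'M[R]_(n, m)) (T : R) : R :=
  \int[lebesgue_measure]_(tau in `[0, T]) inorm (expmx ((T - tau) *: Ae) *m B).

Definition alpha1 (n : nat) (Ae : 'M[R]_n) (T : R) : R :=
  sup [set inorm (expmx (t *: Ae)) | t in `[0, T]].

Definition alpha2 (n : nat) (Ae : 'M[R]_n) (T : R) : R :=
  sup [set (\int[lebesgue_measure]_(tau in `[0, t])
             inorm (expmx ((t - tau) *: Ae) *m invmx (PhiT Ae T)
                      *m expmx (T *: Ae))) | t in `[0, T]].

Definition gamma0 (n m : nat) (Ae : 'M[R]_n) (B : 'M[R]_(n, m)) (T bf : R) : R :=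
  bf * alpha0 Ae B T * (alpha1 Ae T + alpha2 Ae T + 1).

(* The closed-loop adaptive system with the L1 adaptive controller
   (state dimension n = m + p, p = n - m; B^perp : n x p),
   written in integral form on [0, +oo).
   sh = [sigma_hat_1; sigma_hat_2]. *)
Definition adaptive_sol (m p : nat) (Am : 'M[R]_(m + p)) (Bv : 'M[R]_(m + p, m))
  (B : 'M[R]_(m + p, m)) (Bp : 'M[R]_(m + p, p)) (Ae : 'M[R]_(m + p))
  (kf : 'I_m -> R) (T : R) (v : sgn m) (f : R -> 'cV[R]_(m + p) -> 'cV[R]_m)
  (x0 : 'cV[R]_(m + p))
  (x xh : sgn (m + p)) (sh : sgn (m + p)) (ua : sgn m) : Prop :=
  {within [set t : R | 0 <= t], continuous x} /\
  {within [set t : R | 0 <= t], continuous xh} /\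
  (forall t, 0 <= t ->
     x t = x0 + vint (fun tau => Am *m x tau + Bv *m v tau
                                  + B *m (ua tau + f tau (x tau))) 0 t) /\
  (forall t, 0 <= t ->
     xh t = x0 + vint (fun tau => Am *m x tau + Bv *m v tau
                                   + B *m (ua tau + usubmx (sh tau))
                                   + Bp *m dsubmx (sh tau)
                                   + Ae *m (xh tau - x tau)) 0 t) /\
  (forall (i : nat) t, i%:R * T <= t < i.+1%:R * T ->
     sh t = - (invmx (row_mx B Bp) *m invmx (PhiT Ae T) *m expmx (T *: Ae)
               *m (xh (i%:R * T) - x (i%:R * T)))) /\
  (forall t, 0 <= t -> ua t = - filt kf (fun tau => usubmx (sh tau)) t).

Definition ref_sol (n m : nat) (Am : 'M[R]_n) (Bv : 'M[R]_(n, m))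
  (B : 'M[R]_(n, m)) (kf : 'I_m -> R) (v : sgn m) (f : R -> 'cV[R]_n -> 'cV[R]_m)
  (x0 : 'cV[R]_n) (xr : sgn n) (ur : sgn m) : Prop :=
  {within [set t : R | 0 <= t], continuous xr} /\
  (forall t, 0 <= t ->
     xr t = x0 + vint (fun tau => Am *m xr tau + Bv *m v tau
                                   + B *m (ur tau + f tau (xr tau))) 0 t) /\
  (forall t, 0 <= t -> ur t = - filt kf (fun tau => f tau (xr tau)) t).

End L1Defs.

(* Main.v *)
(** A Hurwitz matrix [A] has exponentially decaying [e^{tA}]: if
    [e^{tA} (A - z) M] decays and [Re z < 0] then so does [e^{tA} M], and by
    Cayley-Hamilton the product of the [A - z] over the complex eigenvalues [z]
    vanishes.  Hence all the transfer functions involved have finite L1 norms,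
    and by causality such a norm bounds the output on [[0, t]] by the input on
    [[0, t]].

    As long as [|x| <= rho], the adaptive law cancels at each sampling instant
    the state of the prediction error [xh - x], which therefore stays below
    [gamma0].  By integration by parts, filtering [sigma_hat_1 - f(t, x)] is the
    same as applying [C(s) B^+ (s - Ae)] to the prediction error, so that
    [xr - x = Gxm (f(t, xr) - f(t, x)) + Hxm C B^+ (s - Ae) (xh - x)].  Under
    (C1) the reference state never reaches the boundary of [Omega rho_r], and
    under (C2)-(C3) the difference [xr - x] never reaches [gamma1], by two
    continuity arguments. *)

From HB Require Import structures.
From mathcomp Require Import all_boot all_order all_algebra.
From mathcomp Require Import all_classical all_reals all_analysis.
From mathcomp Require Import measurable_realfun complex ring lra.
Require Import Defs.
Import Order.TTheory GRing.Theory Num.Theory.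
Import numFieldNormedType.Exports.
Local Open Scope classical_set_scope.
Local Open Scope ring_scope.
Set Implicit Arguments.
Unset Strict Implicit.
Unset Printing Implicit Defensive.

(** * Locally bounded measurable functions and integration by parts *)

Section LocallyBoundedMeasurable.
Variable R : realType.
Implicit Types (f g : R -> R) (a b c t s : R).
Local Notation mu := (@lebesgue_measure R).

(** The estimate [sh] jumps at the sampling times, and the inputs over which [L1norm] takes its
    supremum are merely bounded and measurable. So no state is ever differentiated: systems are
    integral equations, and every signal is only known to be measurable and bounded on each
    [[0, b]]. This class is closed under sums, products, primitives and convolution with e^{tA};
    variation of constants and the filter identity both reduce to one integration by parts valid in
    it.

    The estimates are circular: f is controlled only while the state lies in a ball, and the state
    only while f is controlled. Every bound is therefore conditional on the past [[0, t]], and the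
    strictness of (C1) and (C3) turns a bound assumed on the past into a strictly better one at time
    t.

    (C2) makes the loop from [xr - x] through the increment of f back to [xr - x] a contraction.
    Solving the resulting inequality S <= q S + c for S produces the quotient in (C3). *)

Definition locbm f := forall b,
  measurable_fun `[0, b] f /\ exists M, forall t, 0 <= t <= b -> `|f t| <= M.

Lemma locbm_ext f g : (forall t, 0 <= t -> f t = g t) -> locbm f -> locbm g.
Proof.
move=> fg okf b; have [mf [M fM]] := okf b; split.
  apply: eq_measurable_fun mf => t; rewrite inE/= in_itv/= => /andP[t0 _].
  exact: fg.
by exists M => t /[dup] /fM + /andP[t0 _]; rewrite fg.
Qed.

Lemma locbm_cst c : locbm (fun=> c).
Proof. by move=> b; split; [exact: measurable_cst|exists `|c|]. Qed.

Lemma locbmD f g : locbm f -> locbm g -> locbm (fun t => f t + g t).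
Proof.
move=> okf okg b; have [mf [M fM]] := okf b; have [mg [N gN]] := okg b.
split; first exact: measurable_funD.
by exists (M + N) => t tb; rewrite (le_trans (ler_normD _ _))// lerD ?fM ?gN.
Qed.

Lemma locbmM f g : locbm f -> locbm g -> locbm (fun t => f t * g t).
Proof.
move=> okf okg b; have [mf [M fM]] := okf b; have [mg [N gN]] := okg b.
split; first exact: measurable_funM.
by exists (M * N) => t tb; rewrite normrM ler_pM ?fM ?gN.
Qed.

Lemma locbmN f : locbm f -> locbm (fun t => - f t).
Proof.
move=> okf; apply: locbm_ext (locbmM (locbm_cst (-1)) okf) => t _.
by rewrite mulN1r.
Qed.

Lemma locbmB f g : locbm f -> locbm g -> locbm (fun t => f t - g t).
Proof. by move=> okf okg; apply: locbmD => //; exact: locbmN. Qed.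

Lemma locbm_sum (I : Type) (r : seq I) (P : pred I) (F : I -> R -> R) :
  (forall i, locbm (F i)) -> locbm (fun t => \sum_(i <- r | P i) F i t).
Proof.
move=> okF; elim: r => [|i r IH].
  by apply: locbm_ext (locbm_cst 0) => t _; rewrite big_nil.
apply: locbm_ext (_ : locbm (fun t => (if P i then F i t else 0) +
    \sum_(j <- r | P j) F j t)) => [t _|].
  by rewrite big_cons; case: (P i); rewrite ?add0r.
by apply: locbmD => //; case: (P i) => //; exact: locbm_cst.
Qed.

Lemma within_continuous_locbm f :
  (forall b, {within `[0, b], continuous f}) -> locbm f.
Proof.
move=> cf b; split; first by apply: subspace_continuous_measurable_fun.
have /compact_bounded[M [_ mrt]] :=
  continuous_compact (cf b) (@segment_compact R 0 b).
exists (M + 1) => t tb; apply: mrt; first by rewrite ltrDl.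
by exists t => //=; rewrite in_itv.
Qed.

Lemma continuous_locbm f : continuous f -> locbm f.
Proof.
by move=> cf; apply: within_continuous_locbm => b; exact: continuous_subspaceT.
Qed.

Lemma lipschitz_within_continuous f (K a b : R) :
  (forall s t, a <= s <= b -> a <= t <= b -> s <= t ->
    `|f t - f s| <= K * (t - s)) ->
  {within `[a, b], continuous f}.
Proof.
move=> lf; apply/subspace_continuousP => t; rewrite /= in_itv/= => tb.
(* The sign of [K] is unknown; this is a positive Lipschitz constant, by which one can divide. *)
have K0 : 0 < `|K| + 1 by rewrite ltr_wpDl.
apply/cvgrPdist_lt => e e0; rewrite near_withinE; near=> s => /=.
rewrite in_itv/= => sb.
have lip : `|f t - f s| <= (`|K| + 1) * `|t - s|.
  have [st|/ltW ts] := leP s t.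
    rewrite (le_trans (lf _ _ sb tb st))// [`|t - s|]ger0_norm ?subr_ge0//.
    rewrite ler_wpM2r ?subr_ge0// (le_trans (ler_norm _))// lerDl//.
  rewrite distrC (le_trans (lf _ _ tb sb ts))// distrC.
  rewrite [`|s - t|]ger0_norm ?subr_ge0//.
  by rewrite ler_wpM2r ?subr_ge0// (le_trans (ler_norm _))// lerDl.
rewrite (le_lt_trans lip)// mulrC -ltr_pdivlMr//.
near: s.
by have /cvgrPdist_lt/(_ _ (divr_gt0 e0 K0)) := @cvg_id _ (nbhs t).
Unshelve. all: by end_near. Qed.

Lemma locbm_integrable f a b : locbm f -> 0 <= a ->
  mu.-integrable `[a, b] (EFin \o f).
Proof.
move=> okf a0; have [mf [M fM]] := okf b.
apply: measurable_bounded_integrable => //.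
- exact/compact_finite_measure/segment_compact.
- apply: measurable_funS mf => //.
  by apply: subset_itvr; rewrite bnd_simp.
- exists M; split; first exact: num_real.
  move=> N MN t; rewrite /= in_itv/= => /andP[at_ tb].
  by apply: le_trans (ltW MN); rewrite fM// (le_trans a0 at_).
Qed.

Lemma Rint_cst a b c : a <= b -> \int[mu]_(x in `[a, b]) c = c * (b - a).
Proof.
move=> ab; rewrite Rintegral_cst//= lebesgue_measure_itv/= lte_fin.
case: ltP => //= ba; suff -> : a = b by rewrite subrr.
by apply/eqP; rewrite eq_le ab.
Qed.

Lemma Rint_sub f a b c : locbm f -> 0 <= a -> a <= b -> b <= c ->
  \int[mu]_(x in `[a, c]) f x - \int[mu]_(x in `[a, b]) f x =
  \int[mu]_(x in `[b, c]) f x.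
Proof.
move=> okf a0 ab bc.
rewrite (@Rintegral_itvB R f _ _ b) ?bnd_simp//; last exact: locbm_integrable.
rewrite Rintegral_itv_obnd_cbnd//.
apply: integrableS (locbm_integrable c okf (le_trans a0 ab)) => //.
by apply: subset_itvr; rewrite bnd_simp.
Qed.

Lemma Rint_norm_le f g a b : locbm f -> locbm g -> 0 <= a ->
  (forall t, a <= t <= b -> `|f t| <= g t) ->
  `|\int[mu]_(x in `[a, b]) f x| <= \int[mu]_(x in `[a, b]) g x.
Proof.
move=> okf okg a0 fg.
rewrite (le_trans (le_normr_Rintegral _ (locbm_integrable b okf a0)))//.
apply: le_Rintegral => //.
- exact: integrable_norm (locbm_integrable b okf a0).
- exact: locbm_integrable.
Qed.

Lemma Rint_norm_le_cst f a b c : locbm f -> 0 <= a -> a <= b ->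
  (forall t, a <= t <= b -> `|f t| <= c) ->
  `|\int[mu]_(x in `[a, b]) f x| <= c * (b - a).
Proof.
move=> okf a0 ab fc; rewrite -Rint_cst//.
exact: Rint_norm_le okf (locbm_cst c) a0 fc.
Qed.

Lemma RintD f g a b : locbm f -> locbm g -> 0 <= a ->
  \int[mu]_(x in `[a, b]) (f x + g x) =
  \int[mu]_(x in `[a, b]) f x + \int[mu]_(x in `[a, b]) g x.
Proof.
by move=> okf okg a0; apply: RintegralD => //; exact: locbm_integrable.
Qed.

Lemma RintZl f a b c : locbm f -> 0 <= a ->
  \int[mu]_(x in `[a, b]) (c * f x) = c * \int[mu]_(x in `[a, b]) f x.
Proof. by move=> okf a0; apply: RintegralZl => //; exact: locbm_integrable. Qed.

Lemma Rint_sum (I : Type) (r : seq I) (F : I -> R -> R) a b :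
  (forall i, locbm (F i)) -> 0 <= a ->
  \int[mu]_(x in `[a, b]) (\sum_(i <- r) F i x) =
  \sum_(i <- r) \int[mu]_(x in `[a, b]) F i x.
Proof.
move=> okF a0; elim: r => [|i r IH].
  rewrite big_nil -[RHS](mul0r (\int[mu]_(x in `[a, b]) 0)) -RintZl//.
    by apply: eq_Rintegral => x _; rewrite big_nil mul0r.
  exact: locbm_cst.
rewrite big_cons -IH -RintD//; last exact: locbm_sum.
by apply: eq_Rintegral => x _; rewrite big_cons.
Qed.

Lemma locbm_primitive f : locbm f -> locbm (fun t => \int[mu]_(x in `[0, t]) f x).
Proof.
move=> okf; apply: within_continuous_locbm => b.
have [_ [M fM]] := okf b.
apply: (@lipschitz_within_continuous _ M) => s t /andP[s0 sb] /andP[t0 tb] st.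
rewrite Rint_sub//; apply: Rint_norm_le_cst => // r /andP[sr rt].
by rewrite fM// (le_trans s0 sr) (le_trans rt tb).
Qed.

(** Halving every interval halves the total of the quadratic errors, so after [n] bisections an
    increment is at most [C * (t - s) ^+ 2 / 2 ^+ n]. This plays the part of a vanishing derivative,
    using only times in [[0, b]]. *)
Lemma quadratic_modulus_cst (H : R -> R) (C b : R) : 0 <= b ->
  (forall s t, 0 <= s -> s <= t -> t <= b -> `|H t - H s| <= C * (t - s) ^+ 2) ->
  H b = H 0.
Proof.
move=> b0 HC.
have C2 n : forall s t, 0 <= s -> s <= t -> t <= b ->
    `|H t - H s| <= C * (t - s) ^+ 2 / 2 ^+ n.
  elim: n => [|n IH] s t s0 st tb; first by rewrite expr0 divr1 HC.
  have h1 := IH s ((s + t) / 2) s0 ltac:(lra) ltac:(lra).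
  have h2 := IH ((s + t) / 2) t ltac:(lra) ltac:(lra) tb.
  rewrite -[H t](subrK (H ((s + t) / 2))) -addrA.
  rewrite (le_trans (ler_normD _ _))// (le_trans (lerD h2 h1))//.
  rewrite [2 ^+ n.+1]exprS invfM !mulrA; set p := (2 ^+ n)^-1.
  rewrite -mulrDl ler_wpM2r ?invr_ge0 ?exprn_ge0//.
  by rewrite le_eqVlt; apply/orP; left; apply/eqP; field.
apply/eqP/negPn/negP => ne; pose e := `|H b - H 0|; pose K := C * (b - 0) ^+ 2.
have e0 : 0 < e by rewrite normr_gt0 subr_eq0.
have [n nK] : exists n : nat, K / e < 2 ^+ n.
  exists (Num.bound `|K / e|).
  rewrite (le_lt_trans (ler_norm _))// (lt_le_trans (archi_boundP _))//.
  by rewrite -natrX ler_nat; exact/ltnW/ltn_expl.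
have := C2 n 0 b (lexx 0) b0 (lexx b).
by rewrite -/e -/K leNgt ltr_pdivrMr ?exprn_gt0// mulrC -ltr_pdivrMr// nK.
Qed.

Lemma Rint_FTC2 (F : R -> R) f a b : a <= b -> continuous f ->
  (forall t, is_derive t 1 F (f t)) ->
  \int[mu]_(x in `[a, b]) f x = F b - F a.
Proof.
rewrite le_eqVlt => /predU1P[-> _ _|ab cf dF].
  by rewrite set_itv1 Rintegral_set1 subrr.
have cF : continuous F.
  by move=> t; apply: differentiable_continuous; apply/derivable1_diffP.
rewrite /Rintegral (@continuous_FTC2 _ f F)//.
- exact: continuous_subspaceT.
- split => //.
  + by apply: cvg_at_right_filter; exact: cF.
  + by apply: cvg_at_left_filter; exact: cF.
- by move=> t _; rewrite derive1E derive_val.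
Qed.

(* [w] need not be continuous: both sides have the same increments up to a
   quadratic error. *)
Lemma Rint_by_parts (g g' X w : R -> R) (X0 a b : R) :
  continuous g' -> (forall t, is_derive t 1 g (g' t)) -> locbm w ->
  (forall t, 0 <= t -> X t = X0 + \int[mu]_(x in `[0, t]) w x) ->
  0 <= a -> a <= b ->
  \int[mu]_(x in `[a, b]) (g' x * X x + g x * w x) = g b * X b - g a * X a.
Proof.
move=> cg' dg okw EX.
have cg : continuous g.
  by move=> t; apply: differentiable_continuous; apply/derivable1_diffP.
have [okg okg'] := (continuous_locbm cg, continuous_locbm cg').
have okX : locbm X.
  apply: locbm_ext (locbmD (locbm_cst X0) (locbm_primitive okw)) => t t0.
  by rewrite EX.
have okI : locbm (fun t => g' t * X t + g t * w t).
  by apply: locbmD; exact: locbmM.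
have XB s t : 0 <= s -> s <= t -> X t - X s = \int[mu]_(x in `[s, t]) w x.
  move=> s0 st; rewrite !EX//; last exact: le_trans st.
  by rewrite opprD addrACA subrr add0r Rint_sub.
have gB s t : s <= t -> g t - g s = \int[mu]_(x in `[s, t]) g' x.
  by move=> st; rewrite (@Rint_FTC2 g).
pose H t := g t * X t - \int[mu]_(x in `[0, t]) (g' x * X x + g x * w x).
have H0 t : 0 <= t -> H t = H 0.
  move=> t0; have [_ [M gM]] := okg' t; have [_ [N wN]] := okw t.
  have M0 : 0 <= M by apply: le_trans (gM 0 _); rewrite ?lexx.
  have N0 : 0 <= N by apply: le_trans (wN 0 _); rewrite ?lexx.
  apply: (@quadratic_modulus_cst _ (2 * M * N)) => // r s r0 rs st.
  have s0 := le_trans r0 rs.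
  (* Freezing [X s] and [g r] when splitting the increment of [g * X] makes each term of the
     integrand a bounded factor times an increment over a part of [[r, s]]. Both are at most
     [M * N * (s - r)], and integrating gives the quadratic error. *)
  have -> : H s - H r = \int[mu]_(x in `[r, s])
      (g' x * (X s - X x) + (g r - g x) * w x).
    have -> : H s - H r = g s * X s - g r * X r -
        \int[mu]_(x in `[r, s]) (g' x * X x + g x * w x).
      rewrite -(@Rint_sub (fun x => g' x * X x + g x * w x) 0 r s)//.
      by rewrite /H; ring.
    have -> : g s * X s - g r * X r =
        X s * (g s - g r) + g r * (X s - X r) by ring.
    rewrite gB// XB// -!RintZl// -RintD//; last 2 first.
    - by apply: locbmM => //; exact: locbm_cst.
    - by apply: locbmM => //; exact: locbm_cst.
    rewrite -[X in _ - X]mul1r -mulNr -RintZl// -RintD//; last 2 first.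
    - by apply: locbmD; apply: locbmM => //; exact: locbm_cst.
    - by apply: locbmM => //; exact: locbm_cst.
    by apply: eq_Rintegral => x _; ring.
  have -> : 2 * M * N * (s - r) ^+ 2 = (2 * M * N * (s - r)) * (s - r) by ring.
  apply: Rint_norm_le_cst => //.
    apply: locbmD; apply: locbmM => //; apply: locbmB => //; exact: locbm_cst.
  move=> x /andP[rx xs]; have x0 := le_trans r0 rx.
  have xt := le_trans xs st.
  rewrite (le_trans (ler_normD _ _))// !normrM.
  have h1 : `|X s - X x| <= N * (s - r).
    rewrite XB// (@le_trans _ _ (N * (s - x)))//; last first.
      by rewrite ler_wpM2l// lerB.
    apply: Rint_norm_le_cst => // y /andP[xy ys].
    by rewrite wN// (le_trans x0 xy) (le_trans ys).
  have h2 : `|g r - g x| <= M * (s - r).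
    rewrite distrC gB// (@le_trans _ _ (M * (x - r)))//; last first.
      by rewrite ler_wpM2l// lerB.
    apply: Rint_norm_le_cst => // y /andP[ry yx].
    by rewrite gM// (le_trans r0 ry) (le_trans yx).
  have -> : 2 * M * N * (s - r) = M * (N * (s - r)) + (M * (s - r)) * N by ring.
  by rewrite lerD// ler_pM// ?gM ?wN ?x0.
move=> a0 ab; have b0 := le_trans a0 ab.
rewrite -(@Rint_sub (fun x => g' x * X x + g x * w x) 0 a b)//.
have := H0 b b0; rewrite -(H0 a a0) /H.
by move=> h; lra.
Qed.

Lemma Rint_reflect f (t a b : R) : continuous f -> a <= b ->
  \int[mu]_(x in `[a, b]) f (t - x) = \int[mu]_(x in `[t - b, t - a]) f x.
Proof.
move=> cf ab; rewrite /Rintegral; congr fine.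
have dF (x : R) : is_derive x 1 (fun x : R => t - x) (- 1).
  have := is_deriveB (is_derive_cst t x 1) (is_derive_id x 1).
  by rewrite sub0r.
have EF : derive1 (fun x : R => t - x) = cst (-1).
  by apply/funext => x; rewrite derive1E derive_val.
rewrite (@integration_by_substitution_decreasing _ (fun x => t - x))//.
- by apply: eq_integral => x _; rewrite EF /= !fctE opprK mulr1.
- by move=> x y _ _; rewrite ltrD2l ltrN2.
- by rewrite EF => ? _; exact: cvg_cst.
- by rewrite EF; exact: is_cvg_cst.
- by rewrite EF; exact: is_cvg_cst.
- have cF : continuous (fun x : R => t - x).
    by move=> x; apply: differentiable_continuous; apply/derivable1_diffP.
  split => //.
  + by apply: cvg_at_right_filter; exact: cF.
  + by apply: cvg_at_left_filter; exact: cF.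
- exact: continuous_subspaceT.
Qed.

End LocallyBoundedMeasurable.

(** * Derivatives and limits of scalar functions *)

Section ScalarDerivatives.
Variable R : realType.
Implicit Types (f g : R -> R) (t : R).

Lemma is_derive_mulr f g t df dg : is_derive t 1 f df -> is_derive t 1 g dg ->
  is_derive t 1 (fun s => f s * g s) (df * g t + f t * dg).
Proof.
move=> hf hg; have := is_deriveM hf hg.
by rewrite addrC /GRing.scale/= [g t * df]mulrC.
Qed.

Lemma is_derive_sumr n (h : 'I_n -> R -> R) t (dh : 'I_n -> R) :
  (forall i, is_derive t 1 (h i) (dh i)) ->
  is_derive t 1 (fun s => \sum_(i < n) h i s) (\sum_(i < n) dh i).
Proof.
move=> H; have := is_derive_sum H.
by congr (is_derive t 1 _ _); apply/funext => s; rewrite fct_sumE.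
Qed.

Lemma is_derive_reflect f (c t : R) df : is_derive (c - t) 1 f df ->
  is_derive t 1 (fun s => f (c - s)) (- df).
Proof.
move=> hf.
have h : is_derive t 1 (fun s : R => c - s) (- 1).
  by have := is_deriveB (is_derive_cst c t 1) (is_derive_id t 1); rewrite sub0r.
by have := @is_derive1_comp _ f (fun s => c - s) t df (- 1) hf h; rewrite mulrN1.
Qed.

Lemma is_derive1_continuous f df : (forall t, is_derive t 1 f (df t)) ->
  continuous f.
Proof.
by move=> H t; apply: differentiable_continuous; apply/derivable1_diffP.
Qed.

Lemma continuous_normr f : continuous f -> continuous (fun t => `|f t|).
Proof. by move=> cf t; exact: (continuous_comp (cf t) (@norm_continuous _ _ _)). Qed.

Lemma cvg_sumr n (u : 'I_n -> nat -> R) (l : 'I_n -> R) :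
  (forall i, u i @ \oo --> l i) ->
  (fun N => \sum_(i < n) u i N) @ \oo --> \sum_(i < n) l i.
Proof. by move=> H; apply: cvg_big => [|i _]; [exact: add_continuous|exact: H]. Qed.

Lemma continuous_sumr n (h : 'I_n -> R -> R) :
  (forall i, continuous (h i)) -> continuous (fun s => \sum_(i < n) h i s).
Proof.
move=> H; apply: continuous_big => [|i _]; last exact: H.
exact: add_continuous.
Qed.

End ScalarDerivatives.

(** * The matrix exponential as a power series *)

Section MatrixExponential.
Variables (R : realType) (k : nat) (A : 'M[R]_k).
Implicit Types (B : 'M[R]_k) (t s : R).

Lemma exp_scalemx t l : (t *: A) ^+ l = t ^+ l *: A ^+ l.
Proof.
elim: l => [|l IH]; first by rewrite !expr0 scale1r.
by rewrite !exprS IH -mulmxE -scalemxAl -scalemxAr scalerA.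
Qed.

(** A crude bound, used to dominate the series of each entry by a scalar exponential series. *)
Lemma exp_mx_entry_le l i j :
  `|(A ^+ l) i j| <= (\sum_p \sum_q `|A p q|) ^+ l.
Proof.
set a := \sum_p _; have a0 : 0 <= a by do 2 apply: sumr_ge0 => ? _.
elim: l i j => [|l IH] i j.
  by rewrite !expr0 mxE; case: eqP => _; rewrite ?normr1 ?normr0.
rewrite !exprS mxE (le_trans (ler_norm_sum _ _ _))//.
apply: (@le_trans _ _ (\sum_q `|A i q| * a ^+ l)).
  by apply: ler_sum => q _; rewrite normrM ler_wpM2l.
rewrite -mulr_suml ler_wpM2r ?exprn_ge0// /a [leRHS](bigD1 i)//= lerDl.
by do 2 apply: sumr_ge0 => ? _.
Qed.

(** Taylor coefficients in [t] of an entry of B e^{tA}. The left factor makes the family stable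
    under termwise differentiation, which replaces [B] by [B *m A]. *)
Definition expmx_coef B i j l : R := (B *m A ^+ l) i j / l`!%:R.

Lemma expmx_coef_cvg B i j t : cvgn (pseries (expmx_coef B i j) t).
Proof.
apply: normed_cvg.
pose a := \sum_p \sum_q `|A p q|; pose b := \sum_q `|B i q|.
have a0 : 0 <= a by do 2 apply: sumr_ge0 => ? _.
have b0 : 0 <= b by apply: sumr_ge0 => ? _.
apply: (@series_le_cvg _ _ (fun n => b * exp_coeff (a * `|t|) n)).
- by move=> n; exact: normr_ge0.
- by move=> n; rewrite mulr_ge0// exp_coeff_ge0// mulr_ge0.
- move=> n; rewrite /expmx_coef /exp_coeff/= !normrM normfV normr_nat normrX.
  rewrite exprMn -!mulrA [n`!%:R^-1 * _]mulrC !mulrA.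
  rewrite !ler_wpM2r ?invr_ge0 ?exprn_ge0// mxE.
  rewrite (le_trans (ler_norm_sum _ _ _))// mulr_suml; apply: ler_sum => q _.
  by rewrite normrM ler_wpM2l// exp_mx_entry_le.
- rewrite (_ : series _ = b *: series (exp_coeff (a * `|t|))).
    by apply: is_cvgZr; exact: is_cvg_series_exp_coeff.
  by apply/funext => n; rewrite /series/= fctE /GRing.scale/= mulr_sumr.
Qed.

Lemma expmxE t i j : expmx (t *: A) i j = limn (pseries (expmx_coef 1 i j) t).
Proof.
rewrite mxE; congr (limn _); apply/funext => N.
rewrite /pseries /series/= big_mkord; apply: eq_bigr => l _.
by rewrite /expmx_coef mul1mx exp_scalemx [in LHS]mxE -mulrA mulrC.
Qed.

Lemma cvg_expmx t i j :
  pseries (expmx_coef 1 i j) t @ \oo --> expmx (t *: A) i j.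
Proof. by rewrite expmxE; exact: expmx_coef_cvg. Qed.

Lemma lim_expmx_coef B t i j :
  limn (pseries (expmx_coef B i j) t) = (B *m expmx (t *: A)) i j.
Proof.
rewrite mxE; apply: cvg_lim => //.
rewrite (_ : pseries _ _ = fun N => \sum_q B i q * pseries (expmx_coef 1 q j) t N).
  apply: cvg_sumr => q; apply: cvgM; [exact: cvg_cst|exact: cvg_expmx].
apply/funext => N; rewrite /pseries /series/=.
under [RHS]eq_bigr do rewrite mulr_sumr.
rewrite exchange_big/=; apply: eq_bigr => l _.
rewrite /expmx_coef mxE !mulr_suml; apply: eq_bigr => q _.
by rewrite mul1mx !mulrA.
Qed.

Lemma expmx_comm t : A *m expmx (t *: A) = expmx (t *: A) *m A.
Proof.
apply/matrixP => i j; rewrite -lim_expmx_coef [RHS]mxE; apply: cvg_lim => //.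
rewrite (_ : pseries _ _ = fun N => \sum_q pseries (expmx_coef 1 i q) t N * A q j).
  apply: cvg_sumr => q; apply: cvgM; [exact: cvg_expmx|exact: cvg_cst].
apply/funext => N; rewrite /pseries /series/=.
under [RHS]eq_bigr do rewrite mulr_suml.
rewrite exchange_big/=; apply: eq_bigr => l _.
rewrite /expmx_coef mulmxE -exprS exprSr mxE !mulr_suml; apply: eq_bigr => q _.
by rewrite mul1r; ring.
Qed.

Lemma is_derive_expmx_entry t i j :
  is_derive t 1 (fun s => expmx (s *: A) i j) ((A *m expmx (t *: A)) i j).
Proof.
have dE B : pseries_diffs (expmx_coef B i j) = expmx_coef (B *m A) i j.
  apply/funext => l; rewrite /pseries_diffs /expmx_coef -mulmxA mulmxE -exprS.
  by rewrite factS natrM invfM mulrCA mulVKf// pnatr_eq0.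
rewrite (_ : (fun s => _) = fun s => limn (pseries (expmx_coef 1 i j) s)).
  rewrite -lim_expmx_coef; have := dE 1; rewrite mul1mx => <-.
  apply: (@pseries_snd_diffs _ _ (`|t| + 1)); rewrite ?dE.
  - exact: expmx_coef_cvg.
  - exact: expmx_coef_cvg.
  - exact: expmx_coef_cvg.
  - by rewrite [ltRHS]ger0_norm ?ltrDl// addr_ge0.
by apply/funext => s; rewrite expmxE.
Qed.

Lemma expmx0 : expmx (0 *: A) = 1.
Proof.
apply/matrixP => i j; rewrite expmxE; apply: cvg_lim => //.
apply: (@cvg_near_cst) => //; exists 1%N => // -[//|n] _.
rewrite /pseries /series/= big_nat_recl// big1 ?addr0 => [|l _].
  by rewrite /expmx_coef mul1mx !expr0 mulr1 fact0 divr1.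
by rewrite expr0n mulr0.
Qed.

(** The product e^{(s+t-r)A} e^{rA} has zero derivative in r; the two sides are its values at r = 0
    and r = t. *)
Lemma expmxD s t : expmx ((s + t) *: A) = expmx (s *: A) *m expmx (t *: A).
Proof.
apply/matrixP => i j.
pose h r := \sum_q expmx ((s + t - r) *: A) i q * expmx (r *: A) q j.
have dh (r : R) : is_derive r 1 h 0.
  have H q : is_derive r 1
      (fun r => expmx ((s + t - r) *: A) i q * expmx (r *: A) q j)
      (- (expmx ((s + t - r) *: A) *m A) i q * expmx (r *: A) q j +
       expmx ((s + t - r) *: A) i q * (A *m expmx (r *: A)) q j).
    apply: is_derive_mulr; last exact: is_derive_expmx_entry.
    rewrite -expmx_comm.
    apply: (@is_derive_reflect _ (fun x => expmx (x *: A) i q)).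
    exact: is_derive_expmx_entry.
  have := is_derive_sumr H; congr (is_derive _ _ _ _).
  rewrite big_split/=.
  under eq_bigr do rewrite mulNr.
  rewrite sumrN; apply/eqP; rewrite addrC subr_eq0; apply/eqP.
  have h3 (M N : 'M[R]_k) : \sum_q (M i q * N q j) = (M *m N) i j by rewrite mxE.
  by rewrite !h3 mulmxA.
have := is_derive_0_is_cst 0 t dh; rewrite /h subr0 addrK expmx0.
have h3 (M N : 'M[R]_k) : \sum_q (M i q * N q j) = (M *m N) i j by rewrite mxE.
by rewrite !h3 mulmx1.
Qed.

Lemma continuous_expmx_entry i j : continuous (fun t => expmx (t *: A) i j).
Proof. exact: is_derive1_continuous (fun t => is_derive_expmx_entry t i j). Qed.

End MatrixExponential.

(** * Energy estimate for a planar linear equation with decaying forcing *)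

Section ExponentialDecay.
Variable R : realType.
Implicit Types (u v g : R -> R).

(** Stated for the square because the energy argument controls [u ^+ 2 + v ^+ 2]; [expdecay_bound]
    returns to absolute values. *)
Definition expdecay u := exists C e : R,
  0 < e /\ forall t, 0 <= t -> u t ^+ 2 <= C * expR (- e * t).

Lemma is_derive_expRZ (c t : R) :
  is_derive t 1 (fun s => expR (c * s)) (c * expR (c * t)).
Proof.
have h : is_derive t 1 (fun s : R => c * s) c.
  have := is_derive_mulr (is_derive_cst c t 1) (is_derive_id t 1).
  by rewrite mul0r add0r mulr1.
have := @is_derive1_comp _ expR (fun s => c * s) t _ c (is_derive_expR _) h.
by rewrite mulrC.
Qed.

(* The energy [u^2 + v^2] satisfies [phi' <= a phi + (g1^2 + g2^2) / |a|],
   so it stays below a suitable multiple of a slow enough exponential. *)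
Lemma expdecay_linear_ode u v g1 g2 (a b : R) : a < 0 ->
  (forall t : R, is_derive t 1 u (a * u t - b * v t + g1 t)) ->
  (forall t : R, is_derive t 1 v (b * u t + a * v t + g2 t)) ->
  expdecay g1 -> expdecay g2 -> expdecay u /\ expdecay v.
Proof.
move=> a0 du dv [C1 [e1 [e10 g1C]]] [C2 [e2 [e20 g2C]]].
pose phi t := u t ^+ 2 + v t ^+ 2.
suff [C [e [e0 H]]] : exists C e, 0 < e /\
    forall t, 0 <= t -> phi t <= C * expR (- e * t).
  split; exists C, e; split => // t /H; apply: le_trans.
    by rewrite lerDl sqr_ge0.
  by rewrite lerDr sqr_ge0.
(* No faster than either forcing term, and slow enough that [- a - e] is positive. *)
pose e := Num.min (Num.min e1 e2) (- a / 2).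
have e0 : 0 < e by rewrite !lt_min e10 e20; lra.
have ea : e <= - a / 2 by rewrite ge_min lexx orbT.
have ee1 : e <= e1 by rewrite !ge_min lexx.
have ee2 : e <= e2 by rewrite !ge_min lexx orbT.
pose K := (`|C1| + `|C2|) / - a.
have K0 : 0 <= K by rewrite divr_ge0 ?addr_ge0// oppr_ge0 ltW.
(* Chosen so that [phi 0 <= M] and [K <= M * (- a - e)]: the comparison function starts above [phi]
   and absorbs the forcing. *)
pose M := phi 0 + K / (- a - e).
have ae : 0 < - a - e by lra.
exists M, e; split => // t t0.
have gK s : 0 <= s -> (g1 s ^+ 2 + g2 s ^+ 2) / - a <= K * expR (- e * s).
  move=> s0; rewrite /K mulrAC ler_wpM2r ?invr_ge0 ?oppr_ge0 ?(ltW a0)//.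
  rewrite mulrDl lerD//.
    rewrite (le_trans (g1C s s0))// (@le_trans _ _ (`|C1| * expR (- e1 * s)))//.
      by rewrite ler_wpM2r ?expR_ge0 ?ler_norm.
    by rewrite ler_wpM2l// ler_expR ler_wpM2r// lerN2.
  rewrite (le_trans (g2C s s0))// (@le_trans _ _ (`|C2| * expR (- e2 * s)))//.
    by rewrite ler_wpM2r ?expR_ge0 ?ler_norm.
  by rewrite ler_wpM2l// ler_expR ler_wpM2r// lerN2.
pose dphi s := 2 * (u s * (a * u s - b * v s + g1 s) +
                    v s * (b * u s + a * v s + g2 s)).
have dphiE (s : R) : is_derive s 1 phi (dphi s).
  have hu := is_derive_mulr (du s) (du s); have hv := is_derive_mulr (dv s) (dv s).
  have := is_deriveD hu hv.
  by congr (is_derive s 1 _ _); rewrite /dphi; ring.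
(* With the integrating factor [expR (- a * s)], the differential inequality says that [h] is
   nonincreasing; it starts at [h 0 <= 0]. *)
pose h s := (phi s - M * expR (- e * s)) * expR (- a * s).
pose dh s := (dphi s - M * (- e * expR (- e * s))) * expR (- a * s) +
             (phi s - M * expR (- e * s)) * (- a * expR (- a * s)).
have hE (s : R) : is_derive s 1 h (dh s).
  apply: is_derive_mulr; last exact: is_derive_expRZ.
  apply: is_deriveB.
  have := is_derive_mulr (is_derive_cst M s 1) (is_derive_expRZ (- e) s).
  by rewrite mul0r add0r.
have dh0 s : 0 < s -> dh s <= 0.
  move=> s0; rewrite /dh.
  have -> : (dphi s - M * (- e * expR (- e * s))) * expR (- a * s) +
      (phi s - M * expR (- e * s)) * (- a * expR (- a * s)) =
      (dphi s - a * phi s - M * (- a - e) * expR (- e * s)) * expR (- a * s).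
    ring.
  rewrite pmulr_lle0 ?expR_gt0// subr_le0.
  apply: (@le_trans _ _ (K * expR (- e * s))); last first.
    rewrite ler_wpM2r ?expR_ge0// /M mulrDl divfK ?gt_eqF// lerDr.
    by rewrite mulr_ge0 ?(ltW ae)// addr_ge0 ?sqr_ge0.
  apply: le_trans (gK s (ltW s0)).
  rewrite ler_pdivlMr ?oppr_gt0// /dphi /phi.
  (* The rotation terms in [b] cancel in [dphi], and the gap between the two sides is the sum of
     these squares. *)
  have := sqr_ge0 (a * u s + g1 s); have := sqr_ge0 (a * v s + g2 s).
  nra.
have cm : {within `[0, +oo[, continuous h}.
  by apply: continuous_subspaceT; exact: is_derive1_continuous hE.
have := @ler0_derive1_nincry _ h 0 _ _ cm 0 t (lexx 0) t0.
rewrite /h !mulr0 !expR0 !mulr1 => hh.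
have : (phi t - M * expR (- e * t)) * expR (- a * t) <= 0.
  apply: (le_trans (hh _ _)) => [s _|s|]; first by [].
    by rewrite in_itv/= andbT => s0; rewrite derive1E derive_val dh0.
  by rewrite /M opprD addrA subrr sub0r oppr_le0 divr_ge0// ltW.
by rewrite pmulr_lle0 ?expR_gt0// subr_le0.
Qed.

Lemma expdecay_bound u : expdecay u ->
  exists C e : R, [/\ 0 < e, 0 <= C &
    forall t, 0 <= t -> `|u t| <= C * expR (- e * t)].
Proof.
move=> [C [e [e0 uC]]]; exists (Num.sqrt C), (e / 2); split; first by lra.
  exact: sqrtr_ge0.
have C0 : 0 <= C.
  by have := uC 0 (lexx 0); rewrite mulr0 expR0 mulr1; exact: le_trans (sqr_ge0 _).
move=> t t0; rewrite -(@ler_pXn2r _ 2)// ?nnegrE ?mulr_ge0 ?sqrtr_ge0 ?expR_ge0//.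
rewrite real_normK ?num_real// exprMn sqr_sqrtr// -expRM_natl.
by rewrite (_ : 2 * (- (e / 2) * t) = - e * t) ?uC//; field.
Qed.

End ExponentialDecay.

(** * Decay of the exponential times a fixed matrix *)

Section HurwitzDecay.
Variables (R : realType) (k : nat) (A : 'M[R]_k).
Local Notation E t := (expmx (t *: A)).

Definition mxdecay (X : 'M[R]_k) :=
  forall i j, expdecay (fun t => (E t *m X) i j).

Lemma mxdecay0 : mxdecay 0.
Proof.
move=> i j; exists 0, 1; split => // t _.
by rewrite mulmx0 mxE expr0n mul0r.
Qed.

Lemma is_derive_expmx_mul (X : 'M[R]_k) (i j : 'I_k) (t : R) :
  is_derive t 1 (fun s => (E s *m X) i j) ((E t *m (A *m X)) i j).
Proof.
rewrite (_ : (fun s => _) = fun s => \sum_q E s i q * X q j); last first.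
  by apply/funext => s; rewrite mxE.
have H q : is_derive t 1 (fun s => E s i q * X q j)
    ((A *m E t) i q * X q j + E t i q * 0).
  by apply: is_derive_mulr; exact: is_derive_expmx_entry.
have := is_derive_sumr H; congr (is_derive _ _ _ _).
rewrite mulmxA -expmx_comm [RHS]mxE; apply: eq_bigr => q _.
by rewrite mulr0 addr0.
Qed.

(* [X] and [Y] are the real and imaginary parts of a complex matrix [M]; the
   hypotheses are about those of [(A - (a + ib)) M]. *)
Lemma mxdecay_shift (a b : R) (X Y : 'M[R]_k) : a < 0 ->
  mxdecay (A *m X - a *: X + b *: Y) -> mxdecay (A *m Y - a *: Y - b *: X) ->
  mxdecay X /\ mxdecay Y.
Proof.
move=> a0 dX dY.
suff H i j : expdecay (fun t => (E t *m X) i j) /\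
             expdecay (fun t => (E t *m Y) i j).
  by split => i j; have [] := H i j.
apply: (expdecay_linear_ode (b := b) a0 _ _ (dX i j) (dY i j)) => t.
  have := is_derive_expmx_mul X i j t; congr (is_derive _ _ _ _).
  rewrite !mulmxDr mulmxN -!scalemxAr.
  by move: (E t *m (A *m X)) (E t *m X) (E t *m Y) => P Q S; rewrite !mxE; ring.
have := is_derive_expmx_mul Y i j t; congr (is_derive _ _ _ _).
rewrite !mulmxDr !mulmxN -!scalemxAr.
by move: (E t *m (A *m Y)) (E t *m X) (E t *m Y) => P Q S; rewrite !mxE; ring.
Qed.

End HurwitzDecay.

(** * Complex eigenvalues of a real Hurwitz matrix *)

Section HurwitzSpectrum.
Variables (R : realType) (k : nat).
Local Notation C := R[i].
Local Notation toC := (real_complex R).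
Local Notation re := (@complex.Re R).
Local Notation im := (@complex.Im R).

Lemma hurwitz_root (A : 'M[R]_k) (z : C) : hurwitz A ->
  root (char_poly (map_mx toC A)) z -> re z < 0.
Proof.
move=> hA; set Ac := map_mx toC A => rz.
(* [eigenvalue] is about row vectors and [hurwitz] about columns. The transpose has the same
   characteristic polynomial, and the real and imaginary parts of its row eigenvector are the [x]
   and [y] of [hurwitz]. *)
have : eigenvalue Ac^T z.
  rewrite eigenvalue_root_char; move: rz; congr (root _ z).
  rewrite /char_poly -det_tr; congr (\det _).
  by apply/matrixP => i j; rewrite !mxE eq_sym.
case/eigenvalueP => v vA v0.
have Av i : \sum_q toC (A i q) * v 0 q = z * v 0 i.
  have /matrixP/(_ 0 i) := vA; rewrite !mxE => <-.
  by apply: eq_bigr => q _; rewrite !mxE mulrC.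
pose x : 'cV[R]_k := \col_i re (v 0 i); pose y : 'cV[R]_k := \col_i im (v 0 i).
apply: (hA (re z) (im z) x y).
- rewrite -negb_and; apply: contra v0 => /andP[/eqP x0 /eqP y0].
  apply/eqP/rowP => i; have /colP/(_ i) := x0; have /colP/(_ i) := y0.
  by rewrite !mxE; case: (v 0 i) => /= ? ? -> ->.
- apply/colP => i; have := congr1 re (Av i).
  rewrite raddf_sum/= !mxE; case: z (v 0 i) {Av vA rz} => za zb [va vb] /= <-.
  by apply: eq_bigr => q _; rewrite mxE; case: (v 0 q) => ? ?/=; ring.
- apply/colP => i; have := congr1 im (Av i).
  rewrite raddf_sum/= !mxE; case: z (v 0 i) {Av vA rz} => za zb [va vb] /=.
  rewrite addrC => <-.
  by apply: eq_bigr => q _; rewrite mxE; case: (v 0 q) => ? ?/=; ring.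
Qed.

(** The exponential is real, so a complex matrix is carried as the pair of its real and imaginary
    parts. Each induction step strips the leftmost factor, the parts of [(Ac - z) N] being exactly
    the forcing matrices of [mxdecay_shift]. *)
Lemma mxdecay_spectrum (A : 'M[R]_k) (s : seq C) (M : 'M[C]_k) :
  (forall z, z \in s -> re z < 0) ->
  let P := (\prod_(z <- s) (map_mx toC A - z%:M)) *m M in
  mxdecay A (map_mx re P) -> mxdecay A (map_mx im P) ->
  mxdecay A (map_mx re M) /\ mxdecay A (map_mx im M).
Proof.
elim: s => [|z s IH] sz /=; first by rewrite big_nil mul1mx.
rewrite big_cons -mulmxE -mulmxA.
have {}IH := IH (fun w ws => sz w (@mem_behead _ (z :: s) w ws)).
set N := _ *m M in IH *; move=> dre dim; suff [] : mxdecay A (map_mx re N) /\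
  mxdecay A (map_mx im N) by exact: IH.
clearbody N; clear IH.
apply: (@mxdecay_shift _ _ A (re z) (im z)); first by rewrite sz ?mem_head.
  move: dre; congr (mxdecay A _); apply/matrixP => i j.
  rewrite mulmxBl mul_scalar_mx !mxE raddfB raddf_sum/= -addrA.
  congr (_ + _); last by case: (N i j) (z) => ? ? [? ?] /=; ring.
  by apply: eq_bigr => q _; rewrite !mxE; case: (N q j) => ? ? /=; ring.
move: dim; congr (mxdecay A _); apply/matrixP => i j.
rewrite mulmxBl mul_scalar_mx !mxE raddfB raddf_sum/= -addrA.
congr (_ + _); last by case: (N i j) (z) => ? ? [? ?] /=; ring.
by apply: eq_bigr => q _; rewrite !mxE; case: (N q j) => ? ? /=; ring.
Qed.

End HurwitzSpectrum.

Lemma hurwitz_expdecay (R : realType) (k : nat) (A : 'M[R]_k) (i j : 'I_k) :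
  hurwitz A -> expdecay (fun t => expmx (t *: A) i j).
Proof.
case: k A i j => [A []//|k A i j hA].
pose Ac := map_mx (real_complex R) A.
have [s sE] := closed_field_poly_normal (char_poly Ac).
rewrite (monicP (char_poly_monic Ac)) scale1r in sE.
have sz z : z \in s -> complex.Re z < 0.
  by move=> zs; apply: (hurwitz_root hA); rewrite sE root_prod_XsubC.
have prod0 : \prod_(z <- s) (Ac - z%:M) = 0.
  rewrite -(Cayley_Hamilton Ac) sE rmorph_prod/=; apply: eq_bigr => z _.
  by rewrite rmorphB/= horner_mx_X horner_mx_C.
have := @mxdecay_spectrum _ _ A s 1 sz; rewrite -/Ac prod0 mul0mx /=.
have r0 : map_mx (@complex.Re R) 0 = 0 :> 'M[R]_k.+1.
  by apply/matrixP => p q; rewrite !mxE.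
have i0 : map_mx (@complex.Im R) 0 = 0 :> 'M[R]_k.+1.
  by apply/matrixP => p q; rewrite !mxE.
rewrite r0 i0 => /(_ (mxdecay0 A) (mxdecay0 A))[+ _] => /(_ i j).
congr expdecay; apply/funext => t.
rewrite (_ : map_mx _ _ = 1) ?mulmx1//.
by apply/matrixP => p q; rewrite !mxE; case: (p == q).
Qed.

(** * The induced infinity-norm *)

Section InducedNorm.
Variable R : realType.

Lemma inorm_ge0 a b (M : 'M[R]_(a, b)) : 0 <= inorm M.
Proof. exact: bigmax_ge_id. Qed.

Lemma inorm_le a b (M : 'M[R]_(a, b)) c : 0 <= c ->
  (forall i, \sum_j `|M i j| <= c) -> inorm M <= c.
Proof. by move=> c0 Mc; apply: bigmax_le. Qed.

Lemma inorm_row_le a b (M : 'M[R]_(a, b)) i : \sum_j `|M i j| <= inorm M.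
Proof. exact: (le_bigmax _ (fun i => \sum_j `|M i j|)). Qed.

Lemma inorm_col_le a (x : 'cV[R]_a) c : 0 <= c ->
  (forall i, `|x i 0| <= c) -> inorm x <= c.
Proof. by move=> c0 xc; apply: inorm_le => // i; rewrite big_ord1. Qed.

Lemma inorm_col_ge a (x : 'cV[R]_a) i : `|x i 0| <= inorm x.
Proof. by have := inorm_row_le x i; rewrite big_ord1. Qed.

Lemma inorm0 a b : inorm (0 : 'M[R]_(a, b)) = 0.
Proof.
apply/le_anti; rewrite inorm_ge0 andbT; apply: inorm_le => // i.
by rewrite big1// => j _; rewrite mxE normr0.
Qed.

Lemma inormD a b (M N : 'M[R]_(a, b)) : inorm (M + N) <= inorm M + inorm N.
Proof.
apply: inorm_le; first by rewrite addr_ge0 ?inorm_ge0.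
move=> i; rewrite (le_trans _ (lerD (inorm_row_le M i) (inorm_row_le N i)))//.
by rewrite -big_split/=; apply: ler_sum => j _; rewrite mxE ler_normD.
Qed.

Lemma inormN a b (M : 'M[R]_(a, b)) : inorm (- M) = inorm M.
Proof.
apply: eq_bigr => i _; apply: eq_bigr => j _.
by rewrite mxE normrN.
Qed.

Lemma inormB a b (M N : 'M[R]_(a, b)) : inorm (M - N) = inorm (N - M).
Proof. by rewrite -inormN opprB. Qed.

Lemma inorm_mulmx a b (M : 'M[R]_(a, b)) (x : 'cV[R]_b) :
  inorm (M *m x) <= inorm M * inorm x.
Proof.
apply: inorm_col_le; first by rewrite mulr_ge0 ?inorm_ge0.
move=> i; rewrite mxE (le_trans (ler_norm_sum _ _ _))//.
apply: (@le_trans _ _ (\sum_j `|M i j| * inorm x)).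
  by apply: ler_sum => j _; rewrite normrM ler_wpM2l// inorm_col_ge.
by rewrite -mulr_suml ler_wpM2r ?inorm_ge0// inorm_row_le.
Qed.

Lemma inormZ_le a (x : 'cV[R]_a) c : inorm (c *: x) <= `|c| * inorm x.
Proof.
apply: inorm_col_le; first by rewrite mulr_ge0 ?inorm_ge0.
by move=> i; rewrite mxE normrM ler_wpM2l// inorm_col_ge.
Qed.

Lemma inorm_le0 a (x : 'cV[R]_a) : inorm x <= 0 -> x = 0.
Proof.
move=> x0; apply/colP => i; rewrite mxE; apply/eqP; rewrite -normr_le0.
exact: le_trans (inorm_col_ge x i) x0.
Qed.

Lemma continuous_inorm a b (F : R -> 'M[R]_(a, b)) :
  (forall i j, continuous (fun t => F t i j)) ->
  continuous (fun t => inorm (F t)).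
Proof.
move=> cF; apply: continuous_big => [|i _].
  move=> x; apply: (continuous_comp (f := fun x : R * R => x)
    (g := fun x : R * R => Num.max x.1 x.2)) => //.
  by apply: continuous_max => y; [exact: cvg_fst|exact: cvg_snd].
by apply: continuous_sumr => j; exact: continuous_normr.
Qed.

End InducedNorm.

(** * Matrix-valued signals and variation of constants *)

Section MatrixSignals.
Variable R : realType.
Local Notation mu := (@lebesgue_measure R).

Definition mxlocbm a b (F : R -> 'M[R]_(a, b)) :=
  forall i j, locbm (fun t => F t i j).

Lemma mxlocbm_ext a b (F G : R -> 'M[R]_(a, b)) :
  (forall t, 0 <= t -> F t = G t) -> mxlocbm F -> mxlocbm G.
Proof. by move=> FG oF i j; apply: locbm_ext (oF i j) => t /FG ->. Qed.

Lemma mxlocbm_cst a b (M : 'M[R]_(a, b)) : mxlocbm (fun=> M).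
Proof. by move=> i j; exact: locbm_cst. Qed.

Lemma mxlocbmD a b (F G : R -> 'M[R]_(a, b)) :
  mxlocbm F -> mxlocbm G -> mxlocbm (fun t => F t + G t).
Proof.
move=> oF oG i j; apply: locbm_ext (locbmD (oF i j) (oG i j)) => t _.
by rewrite mxE.
Qed.

Lemma mxlocbmN a b (F : R -> 'M[R]_(a, b)) :
  mxlocbm F -> mxlocbm (fun t => - F t).
Proof.
by move=> oF i j; apply: locbm_ext (locbmN (oF i j)) => t _; rewrite mxE.
Qed.

Lemma mxlocbmB a b (F G : R -> 'M[R]_(a, b)) :
  mxlocbm F -> mxlocbm G -> mxlocbm (fun t => F t - G t).
Proof. by move=> oF oG; apply: mxlocbmD => //; exact: mxlocbmN. Qed.

Lemma mxlocbmM a b c (F : R -> 'M[R]_(a, b)) (G : R -> 'M[R]_(b, c)) :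
  mxlocbm F -> mxlocbm G -> mxlocbm (fun t => F t *m G t).
Proof.
move=> oF oG i j.
apply: locbm_ext (_ : locbm (fun t => \sum_q F t i q * G t q j)) => [t _|].
  by rewrite mxE.
by apply: locbm_sum => q; exact: locbmM.
Qed.

Lemma mxlocbmMl a b c (M : 'M[R]_(a, b)) (G : R -> 'M[R]_(b, c)) :
  mxlocbm G -> mxlocbm (fun t => M *m G t).
Proof. by move=> oG; apply: mxlocbmM => //; exact: mxlocbm_cst. Qed.

Lemma mxlocbmZ a b (c : R) (F : R -> 'M[R]_(a, b)) :
  mxlocbm F -> mxlocbm (fun t => c *: F t).
Proof.
move=> oF i j; apply: locbm_ext (locbmM (locbm_cst c) (oF i j)) => t _.
by rewrite mxE.
Qed.

Lemma continuous_mxlocbm a b (F : R -> 'M[R]_(a, b)) :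
  (forall i j, continuous (fun t => F t i j)) -> mxlocbm F.
Proof. by move=> cF i j; exact: continuous_locbm. Qed.

Lemma mxlocbm_bounded a (F : R -> 'cV[R]_a) (b : R) : mxlocbm F ->
  exists M, 0 <= M /\ forall t, 0 <= t <= b -> inorm (F t) <= M.
Proof.
move=> oF.
have /choice[m mP] : forall i, exists M, forall t, 0 <= t <= b -> `|F t i 0| <= M.
  by move=> i; have [_] := oF i 0 b.
exists (\sum_i `|m i|); split; first by apply: sumr_ge0.
move=> t tb; apply: inorm_col_le => [|i]; first by apply: sumr_ge0.
rewrite (le_trans (mP i t tb))// (le_trans (ler_norm _))//.
by rewrite (bigD1 i)//= lerDl; apply: sumr_ge0.
Qed.

Lemma eq_vint a (f g : R -> 'cV[R]_a) (s t : R) :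
  (forall r, s <= r <= t -> f r = g r) -> vint f s t = vint g s t.
Proof.
move=> fg; apply/colP => i; rewrite !mxE; apply: eq_Rintegral => r.
by rewrite inE/= in_itv/= => /fg ->.
Qed.

Lemma vintxx a (f : R -> 'cV[R]_a) (t : R) : vint f t t = 0.
Proof. by apply/colP => i; rewrite !mxE set_itv1 Rintegral_set1. Qed.

Lemma vintD a (f g : R -> 'cV[R]_a) (s t : R) : mxlocbm f -> mxlocbm g ->
  0 <= s -> vint (fun r => f r + g r) s t = vint f s t + vint g s t.
Proof.
move=> of_ og s0; apply/colP => i; rewrite !mxE -RintD//.
by apply: eq_Rintegral => r _; rewrite mxE.
Qed.

Lemma mulmx_vint a b (M : 'M[R]_(b, a)) (f : R -> 'cV[R]_a) (s t : R) :
  mxlocbm f -> 0 <= s -> M *m vint f s t = vint (fun r => M *m f r) s t.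
Proof.
move=> of_ s0; apply/colP => i; rewrite !mxE.
under eq_bigr do rewrite mxE -RintZl//.
rewrite -Rint_sum//; first by apply: eq_Rintegral => r _; rewrite mxE.
by move=> q; apply: locbmM => //; exact: locbm_cst.
Qed.

Lemma vintN a (f : R -> 'cV[R]_a) (s t : R) : mxlocbm f -> 0 <= s ->
  vint (fun r => - f r) s t = - vint f s t.
Proof.
move=> of_ s0; rewrite -[RHS]mul1mx mulmxN -mulNmx mulmx_vint//.
by apply: eq_vint => r _; rewrite mulNmx mul1mx.
Qed.

Lemma vintB a (f g : R -> 'cV[R]_a) (s t : R) : mxlocbm f -> mxlocbm g ->
  0 <= s -> vint (fun r => f r - g r) s t = vint f s t - vint g s t.
Proof. by move=> of_ og s0; rewrite vintD ?vintN//; exact: mxlocbmN. Qed.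

Lemma vint_sub a (f : R -> 'cV[R]_a) (r s t : R) : mxlocbm f ->
  0 <= r -> r <= s -> s <= t -> vint f r t - vint f r s = vint f s t.
Proof.
by move=> of_ r0 rs st; apply/colP => i; rewrite !mxE Rint_sub.
Qed.

Lemma vint_inorm_le a (f : R -> 'cV[R]_a) (g : R -> R) (s t : R) :
  mxlocbm f -> locbm g -> 0 <= s ->
  (forall r, s <= r <= t -> inorm (f r) <= g r) ->
  inorm (vint f s t) <= \int[mu]_(r in `[s, t]) g r.
Proof.
move=> of_ og s0 fg; apply: inorm_col_le => [|i].
  apply: Rintegral_ge0 => r /=; rewrite in_itv/= => /fg; apply: le_trans.
  exact: inorm_ge0.
rewrite mxE; apply: Rint_norm_le => // r /fg; apply: le_trans.
exact: inorm_col_ge.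
Qed.

Lemma mxlocbm_vint a (f : R -> 'cV[R]_a) : mxlocbm f ->
  mxlocbm (fun t => vint f 0 t).
Proof.
move=> of_ i j; apply: locbm_ext (locbm_primitive (of_ i 0)) => t _.
by rewrite mxE.
Qed.

Lemma vint_by_parts a b (G G' : R -> 'M[R]_(b, a)) (X w : R -> 'cV[R]_a)
    (X0 : 'cV[R]_a) (s t : R) :
  (forall i j, continuous (fun r => G' r i j)) ->
  (forall i j (r : R), is_derive r 1 (fun r => G r i j) (G' r i j)) ->
  mxlocbm w -> (forall r, 0 <= r -> X r = X0 + vint w 0 r) ->
  0 <= s -> s <= t ->
  vint (fun r => G' r *m X r + G r *m w r) s t = G t *m X t - G s *m X s.
Proof.
move=> cG' dG ow EX s0 st; apply/colP => i; rewrite !mxE -sumrB.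
have oX : mxlocbm X.
  apply: mxlocbm_ext (mxlocbmD (mxlocbm_cst X0) (mxlocbm_vint ow)) => r r0.
  by rewrite EX.
have cG p q : continuous (fun r => G r p q).
  exact: is_derive1_continuous (dG p q).
transitivity (\int[mu]_(r in `[s, t])
    \sum_q (G' r i q * X r q 0 + G r i q * w r q 0)).
  by apply: eq_Rintegral => r _; rewrite !mxE big_split.
rewrite Rint_sum// => [|q]; last first.
  by apply: locbmD; apply: locbmM => //; exact: continuous_locbm.
apply: eq_bigr => q _.
apply: (@Rint_by_parts _ (fun r => G r i q) _ (fun r => X r q 0) _ (X0 q 0)) => //.
by move=> r r0; rewrite EX// !mxE.
Qed.

Lemma continuous_expmx_reflect k (A : 'M[R]_k) (t : R) i j :
  continuous (fun r => expmx ((t - r) *: A) i j).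
Proof.
apply: (@is_derive1_continuous _ _ (fun r => - (A *m expmx ((t - r) *: A)) i j)).
move=> r; apply: (@is_derive_reflect _ (fun x => expmx (x *: A) i j)).
exact: is_derive_expmx_entry.
Qed.

Lemma mxlocbm_expmx_reflect k (A : 'M[R]_k) (t : R) :
  mxlocbm (fun r => expmx ((t - r) *: A)).
Proof.
by apply: continuous_mxlocbm => i j; exact: continuous_expmx_reflect.
Qed.

Lemma continuous_mulmxl a b c (M : 'M[R]_(a, b)) (F : R -> 'M[R]_(b, c)) :
  (forall i j, continuous (fun t => F t i j)) ->
  forall i j, continuous (fun t => (M *m F t) i j).
Proof.
move=> cF i j; rewrite (_ : (fun t => _) = fun t => \sum_q M i q * F t q j).
  apply: continuous_sumr => q t; apply: cvgM; [exact: cvg_cst|exact: cF].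
by apply/funext => t; rewrite mxE.
Qed.

Lemma continuous_mulmxr a b c (M : 'M[R]_(b, c)) (F : R -> 'M[R]_(a, b)) :
  (forall i j, continuous (fun t => F t i j)) ->
  forall i j, continuous (fun t => (F t *m M) i j).
Proof.
move=> cF i j; rewrite (_ : (fun t => _) = fun t => \sum_q F t i q * M q j).
  apply: continuous_sumr => q t; apply: cvgM; [exact: cF|exact: cvg_cst].
by apply/funext => t; rewrite mxE.
Qed.

Lemma is_derive_mulmxl a b c (M : 'M[R]_(a, b)) (F F' : R -> 'M[R]_(b, c)) :
  (forall i j (t : R), is_derive t 1 (fun r => F r i j) (F' t i j)) ->
  forall i j (t : R), is_derive t 1 (fun r => (M *m F r) i j) ((M *m F' t) i j).
Proof.
move=> dF i j t; rewrite (_ : (fun t => _) = fun t => \sum_q M i q * F t q j).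
  have H q : is_derive t 1 (fun s => M i q * F s q j)
      (0 * F t q j + M i q * F' t q j) by exact: is_derive_mulr.
  have := is_derive_sumr H; congr (is_derive _ _ _ _).
  by rewrite mxE; apply: eq_bigr => q _; rewrite mul0r add0r.
by apply/funext => r; rewrite mxE.
Qed.

(** Integration by parts of [X] against r |-> e^{(t-r)A}: the derivative of the kernel cancels
    [A *m X] and only [w] survives. The initial time [s] is arbitrary because the prediction error
    is propagated from each sampling time. *)
Lemma variation_of_constants k (A : 'M[R]_k) (X w : R -> 'cV[R]_k)
    (X0 : 'cV[R]_k) (s t : R) : mxlocbm X -> mxlocbm w ->
  (forall r, 0 <= r -> X r = X0 + vint (fun x => A *m X x + w x) 0 r) ->
  0 <= s -> s <= t ->
  X t = expmx ((t - s) *: A) *m X s +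
        vint (fun r => expmx ((t - r) *: A) *m w r) s t.
Proof.
move=> oX ow EX s0 st.
pose G r := expmx ((t - r) *: A); pose G' r := - (A *m G r).
have cG' i j : continuous (fun r => G' r i j).
  rewrite (_ : (fun r => _) = fun r => ((- A) *m G r) i j); last first.
    by apply/funext => r; rewrite mulNmx.
  by apply: continuous_mulmxl; exact: continuous_expmx_reflect.
have dG i j (r : R) : is_derive r 1 (fun r => G r i j) (G' r i j).
  rewrite mxE; apply: (@is_derive_reflect _ (fun x => expmx (x *: A) i j)).
  exact: is_derive_expmx_entry.
have oAw : mxlocbm (fun r => A *m X r + w r).
  by apply: mxlocbmD => //; exact: mxlocbmMl.
have := vint_by_parts cG' dG oAw EX s0 st.
rewrite /G subrr expmx0 mul1mx => H.
rewrite -[LHS](subrKC (expmx ((t - s) *: A) *m X s)) -H.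
congr (_ + _); apply: eq_vint => r _.
by rewrite /G' expmx_comm mulmxDr mulNmx mulmxA addKr.
Qed.

End MatrixSignals.

(** * Stable systems and their L1 norms *)

Section StableSystems.
Variable R : realType.
Local Notation mu := (@lebesgue_measure R).

Lemma hurwitz_int_bound k (A : 'M[R]_k) : hurwitz A ->
  exists M, 0 <= M /\ forall i j (t : R), 0 <= t ->
    \int[mu]_(r in `[0, t]) `|expmx ((t - r) *: A) i j| <= M.
Proof.
move=> hA.
have /choice[m mP] : forall ij : 'I_k * 'I_k, exists M, forall t : R, 0 <= t ->
    \int[mu]_(r in `[0, t]) `|expmx ((t - r) *: A) ij.1 ij.2| <= M.
  move=> [i j] /=.
  have [C [e [e0 C0 EC]]] := expdecay_bound (hurwitz_expdecay i j hA).
  have cE (x : R) : continuous (fun r : R => expR (- e * (x - r))).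
    apply: (@is_derive1_continuous _ _ (fun r => - (- e * expR (- e * (x - r))))).
    move=> r; apply: (@is_derive_reflect _ (fun x => expR (- e * x))).
    exact: is_derive_expRZ.
  (* The integral of C e^{-e(t-r)} over [[0, t]] is C (1 - e^{-et}) / e, hence a bound uniform in
     [t]. *)
  exists (C / e) => t t0.
  apply: (@le_trans _ _ (\int[mu]_(r in `[0, t]) (C * expR (- e * (t - r))))).
    rewrite -[leLHS]ger0_norm; last by apply: Rintegral_ge0.
    apply: Rint_norm_le => //.
    - by apply/continuous_locbm/continuous_normr; exact: continuous_expmx_reflect.
    - by apply: locbmM; [exact: locbm_cst|exact: continuous_locbm].
    - by move=> r /andP[r0 rt]; rewrite normr_id EC// subr_ge0.
  rewrite RintZl//; last exact: continuous_locbm.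
  rewrite ler_wpM2l//.
  have dF (r : R) : is_derive r 1 (fun r => e^-1 * expR (- e * (t - r)))
      (expR (- e * (t - r))).
    have h := @is_derive_reflect _ (fun x => expR (- e * x)) t r _
      (is_derive_expRZ (- e) (t - r)).
    have := is_derive_mulr (is_derive_cst e^-1 r 1) h.
    congr (is_derive _ _ _ _).
    by rewrite mul0r add0r mulNr opprK /= mulKf// gt_eqF.
  rewrite (Rint_FTC2 t0 (cE t) dF) subrr mulr0 expR0 mulr1 subr0 gerBl.
  by rewrite mulr_ge0 ?expR_ge0// invr_ge0 ltW.
exists (\sum_ij `|m ij|); split; first by apply: sumr_ge0.
move=> i j t t0; rewrite (le_trans (mP (i, j) t t0))// (le_trans (ler_norm _))//.
by rewrite (bigD1 (i, j))//= lerDl; apply: sumr_ge0.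
Qed.

Lemma mxlocbm_lti_integrand k p (A : 'M[R]_k) (B : 'M[R]_(k, p)) (u : sgn R p)
  (t : R) : mxlocbm u -> mxlocbm (fun r => expmx ((t - r) *: A) *m B *m u r).
Proof.
move=> ou; apply: mxlocbmM => //; apply: mxlocbmM; last exact: mxlocbm_cst.
exact: mxlocbm_expmx_reflect.
Qed.

Section LTI.
Variables (k p q : nat) (A : 'M[R]_k) (B : 'M[R]_(k, p)).
Variables (C : 'M[R]_(q, k)) (D : 'M[R]_(q, p)).
Local Notation F := (lti A B C D).
Implicit Types u v : sgn R p.

Lemma lti_causal u v (t : R) : (forall s, 0 <= s <= t -> u s = v s) ->
  0 <= t -> F u t = F v t.
Proof.
move=> uv t0; rewrite /lti uv ?t0 ?lexx//.
by congr (_ *m _ + _); apply: eq_vint => r /uv ->.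
Qed.

Lemma ltiD u v (t : R) : mxlocbm u -> mxlocbm v ->
  F (fun s => u s + v s) t = F u t + F v t.
Proof.
move=> ou ov; rewrite /lti [D *m (_ + _)]mulmxDr [RHS]addrACA -[C *m _ + C *m _]mulmxDr.
congr (_ *m _ + _).
rewrite -vintD//; try exact: mxlocbm_lti_integrand.
by apply: eq_vint => r _; rewrite mulmxDr.
Qed.

Lemma ltiZ u (c t : R) : mxlocbm u -> F (fun s => c *: u s) t = c *: F u t.
Proof.
move=> ou; rewrite /lti scalerDr -!scalemxAr; congr (_ + _).
rewrite scalemxAr; congr (_ *m _); rewrite -mul_scalar_mx mulmx_vint//; last first.
  exact: mxlocbm_lti_integrand.
apply: eq_vint => r _.
by rewrite mul_scalar_mx -scalemxAr.
Qed.

Lemma ltiB u v (t : R) : mxlocbm u -> mxlocbm v ->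
  F (fun s => u s - v s) t = F u t - F v t.
Proof.
move=> ou ov; rewrite -scaleN1r -ltiZ// -ltiD//; last exact: mxlocbmZ.
by congr (F _ t); apply/funext => s; rewrite scaleN1r.
Qed.

(** Factoring e^{(t-r)A} = e^{tA} e^{-rA} removes [t] from the integrand: the convolution becomes a
    continuous function times a primitive. *)
Lemma mxlocbm_lti u : mxlocbm u -> mxlocbm (F u).
Proof.
move=> ou; apply: mxlocbmD; last exact: mxlocbmMl.
apply: mxlocbmMl; pose h r := expmx (- r *: A) *m B *m u r.
have oh : mxlocbm h.
  have := mxlocbm_lti_integrand A B 0 ou.
  by apply: mxlocbm_ext => r _; rewrite sub0r.
apply: mxlocbm_ext (_ : mxlocbm (fun t => expmx (t *: A) *m vint h 0 t)).
  move=> t t0; rewrite mulmx_vint//; apply: eq_vint => r _.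
  by rewrite /h !mulmxA -expmxD.
apply: mxlocbmM; last exact: mxlocbm_vint.
by apply: continuous_mxlocbm => i j; exact: continuous_expmx_entry.
Qed.

Lemma lti_bounded : hurwitz A -> exists M, forall u, mxlocbm u ->
  (forall s, 0 <= s -> inorm (u s) <= 1) ->
  forall t, 0 <= t -> inorm (F u t) <= M.
Proof.
move=> hA; have [M [M0 MP]] := hurwitz_int_bound hA.
exists (inorm C * (\sum_(j < k) inorm B * M) + inorm D) => u ou u1 t t0.
rewrite (le_trans (inormD _ _))// lerD//; last first.
  rewrite (le_trans (inorm_mulmx _ _))//.
  by rewrite -[leRHS]mulr1 ler_wpM2l ?inorm_ge0 ?u1.
rewrite (le_trans (inorm_mulmx _ _))// ler_wpM2l ?inorm_ge0//.
have S0 : 0 <= \sum_(j < k) inorm B * M.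
  by apply: sumr_ge0 => j _; rewrite mulr_ge0 ?inorm_ge0.
apply: inorm_col_le => // i; rewrite mxE.
pose g j r := inorm B * `|expmx ((t - r) *: A) i j|.
have oE j : locbm (fun r => `|expmx ((t - r) *: A) i j|).
  by apply/continuous_locbm/continuous_normr; exact: continuous_expmx_reflect.
have og j : locbm (g j) by apply: locbmM => //; exact: locbm_cst.
apply: (@le_trans _ _ (\int[mu]_(r in `[0, t]) \sum_j g j r)).
  apply: Rint_norm_le => //; first exact: mxlocbm_lti_integrand.
    exact: locbm_sum.
  move=> r /andP[r0 rt]; rewrite -mulmxA mxE (le_trans (ler_norm_sum _ _ _))//.
  apply: ler_sum => j _; rewrite normrM mulrC ler_wpM2r//.
  rewrite (le_trans (inorm_col_ge _ j))// (le_trans (inorm_mulmx _ _))//.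
  by rewrite -[leRHS]mulr1 ler_wpM2l ?inorm_ge0 ?u1.
rewrite Rint_sum//; apply: ler_sum => j _.
by rewrite RintZl// ler_wpM2l ?inorm_ge0// MP.
Qed.

End LTI.

(** An abstract class that contains the Hurwitz realizations and is closed under composition and
    [u - F u]. It thus covers [Gxm] and [HxmCBsAe] without a joint state-space realization.
    Homogeneity serves to rescale inputs to unit size. *)
Record stable_op p q (F : sgn R p -> sgn R q) : Prop := StableOp {
  stable_causal : forall u v t, (forall s, 0 <= s <= t -> u s = v s) ->
    0 <= t -> F u t = F v t;
  stable_homogeneous : forall u c t, mxlocbm u -> 0 <= t ->
    F (fun s => c *: u s) t = c *: F u t;
  stable_mxlocbm : forall u, mxlocbm u -> mxlocbm (F u);
  stable_bounded : exists M, forall u, mxlocbm u ->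
    (forall s, 0 <= s -> inorm (u s) <= 1) ->
    forall t, 0 <= t -> inorm (F u t) <= M }.

Lemma lti_stable k p q (A : 'M[R]_k) (B : 'M[R]_(k, p)) (C : 'M[R]_(q, k))
  (D : 'M[R]_(q, p)) : hurwitz A -> stable_op (lti A B C D).
Proof.
move=> hA; split; [exact: lti_causal| |exact: mxlocbm_lti|exact: lti_bounded].
by move=> u c t ou _; exact: ltiZ.
Qed.

Lemma stable_comp p q r (F : sgn R q -> sgn R r) (G : sgn R p -> sgn R q) :
  stable_op F -> stable_op G -> stable_op (fun u => F (G u)).
Proof.
move=> [Fc Fh Fo [M FM]] [Gc Gh Go [N GN]]; split.
- move=> u v t uv t0; apply: Fc => // s /andP[s0 st]; apply: Gc => // x /andP[x0 xs].
  by rewrite uv// x0 (le_trans xs).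
- move=> u c t ou t0; rewrite -Fh//; last exact: Go.
  by apply: Fc => // s /andP[s0 _]; exact: Gh.
- by move=> u /Go/Fo.
(* Dividing [G u] by the positive number [|N| + 1], which exceeds the bound of [G], makes it an
   admissible unit input of [F]. *)
- exists ((`|N| + 1) * M) => u ou u1 t t0.
  have N0 : 0 < `|N| + 1 by rewrite ltr_wpDl.
  have -> : F (G u) t = (`|N| + 1) *: F (fun s => (`|N| + 1)^-1 *: G u s) t.
    by rewrite Fh ?scalerA ?divff ?scale1r ?gt_eqF//; exact: Go.
  rewrite (le_trans (inormZ_le _ _))// gtr0_norm// ler_wpM2l ?(ltW N0)//.
  apply: FM => //; first by apply/mxlocbmZ/Go.
  move=> s s0; rewrite (le_trans (inormZ_le _ _))// gtr0_norm ?invr_gt0//.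
  rewrite mulrC ler_pdivrMr// mul1r (le_trans (GN u ou u1 s s0))//.
  by rewrite (le_trans (ler_norm _))// lerDl.
Qed.

Lemma stable_idB p (F : sgn R p -> sgn R p) :
  stable_op F -> stable_op (fun u t => u t - F u t).
Proof.
move=> [Fc Fh Fo [M FM]]; split.
- by move=> u v t uv t0; rewrite (Fc u v)// uv// t0 lexx.
- by move=> u c t ou t0; rewrite Fh// scalerBr.
- by move=> u ou; apply: mxlocbmB => //; exact: Fo.
- exists (1 + M) => u ou u1 t t0.
  by rewrite (le_trans (inormD _ _))// inormN lerD ?u1 ?FM.
Qed.

Lemma unit_input_mxlocbm p (u : sgn R p) : unit_input u -> mxlocbm u.
Proof.
move=> [mu_ u1] i j b; rewrite (ord1 j); split.
  exact: measurable_funTS.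
by exists 1 => t /andP[t0 _]; rewrite (le_trans (inorm_col_ge _ _))// u1.
Qed.

(* Only the input on [[0, t]] matters, so it may be cut off after [t] and
   rescaled to an admissible unit input. *)
Lemma L1norm_bound p q (F : sgn R p -> sgn R q) (u : sgn R p) (c t : R) :
  stable_op F -> mxlocbm u -> 0 <= t ->
  (forall s, 0 <= s <= t -> inorm (u s) <= c) ->
  inorm (F u t) <= L1norm F * c.
Proof.
move=> [Fc Fh Fo [M FM]] ou t0 uc.
have c0 : 0 <= c by apply: le_trans (uc 0 _); rewrite ?inorm_ge0 ?lexx.
(* If [c = 0] then [c^-1 = 0] and [w] vanishes; but so does [u] on [[0, t]], and [u = c w] still
   holds there. *)
pose w (s : R) := if (0 <= s <= t) then c^-1 *: u s else 0.
have w1 s : inorm (w s) <= 1.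
  rewrite /w; case: ifP => [st|_]; last by rewrite inorm0.
  rewrite (le_trans (inormZ_le _ _))//.
  have [->|cN0] := eqVneq c 0; first by rewrite invr0 normr0 mul0r.
  by rewrite normfV ger0_norm// mulrC ler_pdivrMr ?lt_def ?cN0// mul1r uc.
have uw : unit_input w.
  split => // i.
  have [mw _] := locbmM (locbm_cst c^-1) (ou i 0) t.
  rewrite (_ : (fun s => _) = (fun s => c^-1 * u s i 0) \_ `[0, t]).
    by apply: (iffLR (measurable_restrictT _ _) mw).
  apply/funext => s; rewrite patchE /w mem_setE in_itv/=.
  by case: ifP => _; rewrite mxE.
have ow := unit_input_mxlocbm uw.
have -> : F u t = c *: F w t.
  rewrite -Fh//; apply: Fc => // s st; rewrite /w st scalerA.
  have [c00|cN0] := eqVneq c 0; last by rewrite divff// scale1r.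
  rewrite c00 mul0r scale0r; apply: inorm_le0.
  by rewrite -c00 uc.
rewrite (le_trans (inormZ_le _ _))// ger0_norm// mulrC ler_wpM2r//.
(* [sup] dominates its set only when that set is bounded. Stability ensures this for both nested
   suprema, over times and over inputs. *)
have bF v : unit_input v -> has_ubound [set inorm (F v t) | t in [set t : R | 0 <= t]].
  move=> uv; exists M => _ [s /= s0 <-]; apply: FM => //; last by case: uv.
  exact: unit_input_mxlocbm.
apply: (@le_trans _ _ (Linf (F w))).
  by apply: ub_le_sup; [exact: bF|exists t].
apply: ub_le_sup; last by exists w.
exists M => _ [v uv <-]; apply: ge_sup; first by exists (inorm (F v 0)), 0 => /=.
move=> _ [s /= s0 <-]; apply: FM => //; last by case: uv.
exact: unit_input_mxlocbm.
Qed.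

Lemma L1norm_ge0 p q (F : sgn R p -> sgn R q) : stable_op F -> 0 <= L1norm F.
Proof.
move=> sF; have := @L1norm_bound _ _ F (fun=> 0) 1 0 sF (mxlocbm_cst 0) (lexx 0).
rewrite mulr1 => H; apply: le_trans (H _); rewrite ?inorm_ge0// => s _.
by rewrite inorm0.
Qed.

End StableSystems.

(** * Regularity of the closed-loop signals and continuous induction *)

Section SignalRegularity.
Variable R : realType.

Lemma within_ge0_coord k (x : sgn R k) (b : R) i j :
  {within [set t : R | 0 <= t], continuous x} ->
  {within `[0, b], continuous (fun t => x t i j)}.
Proof.
move=> cx.
have {}cx : {within `[0, b], continuous x}.
  apply: continuous_subspaceW cx => t /=.
  by rewrite in_itv/= => /andP[].
move=> t; apply: (@continuous_comp (subspace `[0, b]) 'cV[R]_k R x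
  (fun M => M i j) t (cx t)).
exact: coord_continuous.
Qed.

Lemma within_ge0_mxlocbm k (x : sgn R k) :
  {within [set t : R | 0 <= t], continuous x} -> mxlocbm x.
Proof.
move=> cx i j; apply: within_continuous_locbm => b.
exact: within_ge0_coord.
Qed.

(** On [[0, b]] the trajectory stays in the compact image of that segment, where [f] has Lipschitz
    constants, so the composite is continuous there. *)
Lemma feedback_mxlocbm n m (f : R -> 'cV[R]_n -> 'cV[R]_m) (x : sgn R n) :
  {within [set t : R | 0 <= t], continuous x} ->
  (forall Z : set 'cV[R]_n, compact Z ->
     exists L0 l0 b0 : 'I_m -> R, f_consts f Z L0 l0 b0) ->
  mxlocbm (fun t => f t (x t)).
Proof.
move=> cx fZ j j0; rewrite (ord1 j0) => {j0}.
apply: within_continuous_locbm => b.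
have cxb : {within `[0, b], continuous x}.
  apply: continuous_subspaceW cx => t /=.
  by rewrite in_itv/= => /andP[].
have [L [l [_ [fL _]]]] := fZ _ (continuous_compact cxb (@segment_compact R 0 b)).
apply/subspace_continuousP => t tb.
(* A modulus that visibly tends to 0: the sum of the coordinates dominates [inorm], and the absolute
   values make up for the unknown signs of [L j] and [l j]. *)
pose h (s : R) := `|L j| * \sum_i `|x t i 0 - x s i 0| + `|l j| * `|t - s|.
have h0 : h s @[s --> within `[0, b] (nbhs t)] --> (0 : R).
  rewrite -[X in _ --> X](_ : `|L j| * (\sum_(i < n) `|x t i 0 - x t i 0|) +
      `|l j| * `|t - t| = 0); last first.
    by rewrite big1 => [|i _]; rewrite subrr normr0 ?mulr0 ?addr0.
  apply: cvgD; apply: cvgM; try exact: cvg_cst.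
    apply: cvg_big => [|i _]; first exact: add_continuous.
    apply: cvg_norm; apply: cvgB; first exact: cvg_cst.
    have /subspace_continuousP := @within_ge0_coord _ x b i 0 cx.
    exact.
  apply: cvg_norm; apply: cvgB; first exact: cvg_cst.
  exact: cvg_within_filter cvg_id.
apply/cvgrPdist_lt => e e0.
have /cvgrPdist_lt/(_ e e0) := h0.
rewrite !near_withinE; apply: filterS => s hs sb; have := hs sb.
apply: le_lt_trans; rewrite sub0r normrN.
move: (tb) (sb); rewrite /= !in_itv/= => /andP[t0 _] /andP[s0 _].
have /= H := fL j t s (x t) (x s) t0 s0 (ex_intro2 _ _ t tb erefl)
  (ex_intro2 _ _ s sb erefl).
apply: (le_trans H); apply: le_trans (ler_norm _); apply: lerD.
  rewrite (le_trans (ler_wpM2r (inorm_ge0 _) (ler_norm _)))// ler_wpM2l//.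
  apply: inorm_col_le => [|i]; first by apply: sumr_ge0.
  by rewrite !mxE (bigD1 i)//= lerDl; apply: sumr_ge0.
by rewrite ler_wpM2r// ler_norm.
Qed.

(** Removing the exceptional points and the endpoints leaves an open set on which [v] is continuous;
    on the finite remainder every function is measurable. The horizon is [|b| + 1] because [pw_cont]
    asks for a positive one. *)
Lemma pw_cont_mxlocbm k (v : sgn R k) : bounded_sig v -> pw_cont v -> mxlocbm v.
Proof.
move=> [M vM] cv i j b; rewrite (ord1 j); split; last first.
  by exists M => t /andP[t0 _]; rewrite (le_trans (inorm_col_ge _ _))// vM.
have b0 : 0 < `|b| + 1 by rewrite ltr_wpDl.
apply: (@measurable_funS _ _ _ _ `[0, `|b| + 1]) => //.
  apply: subset_itvl; rewrite bnd_simp (le_trans (ler_norm _))// lerDl//.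
have [s [sc _]] := cv i _ b0.
pose U := `]0, `|b| + 1[%classic `\` [set` s]; pose V := [set` 0 :: `|b| + 1 :: s].
have fV : finite_set V by exact: finite_seq.
have mV W : W `<=` V -> measurable W.
  move=> WV; apply: countable_measurable => //.
  by apply: finite_set_countable; exact: sub_finite_set WV fV.
have oU : open U.
  rewrite /U setDE; apply: openI; first exact: interval_open.
  apply: closed_openC; apply: compact_closed; first exact: norm_hausdorff.
  by apply: finite_compact; exact: finite_seq.
apply: (@measurable_funS _ _ _ _ (U `|` V)).
- by apply: measurableU; [exact: open_measurable|exact: mV].
- move=> t /=; rewrite in_itv/= => /andP[t0 tb].
  have [ts|/negP ts] := boolP (t \in V).
    by right; move: ts; rewrite inE.
  left; move: ts; rewrite inE /V/= !inE => /negP; rewrite !negb_or => /and3P[t1 t2 t3].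
  split; last exact/negP.
  by rewrite /= in_itv/= !lt_neqAle eq_sym t1 t0 t2 tb.
apply/measurable_funU => //; [exact: open_measurable|exact: mV|split].
  apply: open_continuous_measurable_fun => // t; rewrite inE => -[/=].
  by rewrite in_itv/= => tb /negP; exact: sc.
by move=> _ Y mY; apply: mV; exact: subIsetl.
Qed.

Lemma sampled_mxlocbm k (u : sgn R k) (T : R) (a : nat -> 'cV[R]_k) : 0 < T ->
  (forall (i : nat) t, i%:R * T <= t < i.+1%:R * T -> u t = a i) -> mxlocbm u.
Proof.
move=> T0 ua i j b; rewrite (ord1 j).
have H N : measurable_fun `[0, N%:R * T[ (fun t => u t i 0) /\
    exists M, forall t, 0 <= t < N%:R * T -> `|u t i 0| <= M.
  elim: N => [|N [mN [M MN]]].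
    rewrite mul0r set_itvco0; split; first exact: measurable_fun_set0.
    by exists 0 => t /andP[t0 /(le_lt_trans t0)]; rewrite ltxx.
  have NT : N%:R * T <= N.+1%:R * T by rewrite ler_wpM2r ?ler_nat// ltW.
  have N0 : 0 <= N%:R * T by rewrite mulr_ge0// ltW.
  split.
    rewrite (@itv_bndbnd_setU _ _ _ (BLeft (N%:R * T))) ?bnd_simp//.
    apply/measurable_funU => //; split => //.
    apply: eq_measurable_fun (measurable_cst (a N i 0)) => t.
    by rewrite inE/= in_itv/= => /ua ->.
  exists (Num.max M `|a N i 0|) => t /andP[t0 tN].
  have [tn|nt] := ltP t (N%:R * T); first by rewrite le_max MN// t0.
  by rewrite (ua N) ?nt// le_max lexx orbT.
have [mN [M MN]] := H (Num.bound (`|b| / T)).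
have bN : b < (Num.bound (`|b| / T))%:R * T.
  rewrite (le_lt_trans (ler_norm b))// -ltr_pdivrMr//.
  by rewrite archi_boundP// divr_ge0// ltW.
split.
  apply: measurable_funS mN => //; apply: subset_itvl.
  by rewrite bnd_simp.
by exists M => t /andP[t0 tb]; rewrite MN// t0 (le_lt_trans tb).
Qed.

(* Continuous induction along [0, +oo[ *)
Lemma lipschitz_barrier (h : R -> R) (c : R) :
  (forall b, exists K, forall s t, 0 <= s -> s <= t -> t <= b ->
    `|h t - h s| <= K * (t - s)) ->
  h 0 <= c ->
  (forall t, 0 <= t -> (forall s, 0 <= s <= t -> h s <= c) -> h t < c) ->
  forall t, 0 <= t -> h t < c.
Proof.
move=> hK h0 step t1 t10; have [//|ct1] := ltP (h t1) c; exfalso.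
have [K0 K0P] := hK t1; pose K := `|K0| + 1.
have KP s t : 0 <= s -> s <= t -> t <= t1 -> `|h t - h s| <= K * (t - s).
  move=> s0 st tt; rewrite (le_trans (K0P _ _ s0 st tt))//.
  by rewrite ler_wpM2r ?subr_ge0// (le_trans (ler_norm _))// lerDl.
have K_gt0 : 0 < K by rewrite ltr_wpDl.
pose S := [set t | 0 <= t <= t1 /\ forall s, 0 <= s <= t -> h s <= c].
have S0 : S 0.
  split; first by rewrite lexx.
  by move=> s; rewrite -eq_le => /eqP <-.
have ubS : has_ubound S by exists t1 => t [/andP[]].
have supS : has_sup S by split => //; exists 0.
pose tau := sup S.
have tau0 : 0 <= tau by exact: ub_le_sup.
have tau1 : tau <= t1 by apply: ge_sup; [exists 0|move=> t [/andP[]]].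
have below s : 0 <= s -> s < tau -> h s <= c.
  move=> s0 st; have ts : 0 < tau - s by rewrite subr_gt0.
  have [r [_ rc]] := sup_adherent ts supS.
  rewrite subKr => sr; apply: rc; rewrite s0 ltW//.
have htau : h tau <= c.
  have [->//|tauN0] := eqVneq tau 0.
  have tau_gt0 : 0 < tau by rewrite lt_def tauN0.
  apply/ler_addgt0Pr => e e0.
  (* Close enough to [tau] for [h] to change by at most [e] in between, so that [h tau <= c + e]. *)
  pose s := Num.max 0 (tau - e / K).
  have s0 : 0 <= s by rewrite le_max lexx.
  have st : s < tau by rewrite gt_max tau_gt0 ltrBlDr ltrDl divr_gt0.
  have h1 := KP s tau s0 (ltW st) tau1.
  have h2 := below s s0 st.
  have h3 : K * (tau - s) <= e.
    rewrite mulrC -ler_pdivlMr// lerBlDr -lerBlDl le_max lexx orbT//.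
  have := ler_norm (h tau - h s); lra.
have stau : h tau < c.
  apply: step => // s /andP[s0]; rewrite le_eqVlt => /predU1P[->//|].
  exact: below.
have tau_lt : tau < t1.
  rewrite lt_neqAle tau1 andbT; apply/eqP => tt.
  by move: stau; rewrite tt ltNge ct1.
(* The Lipschitz bound keeps [h] below [c] for this long after [tau], which contradicts the choice
   of [tau] as a supremum. *)
pose r := Num.min t1 (tau + (c - h tau) / K).
have taur : tau < r by rewrite lt_min tau_lt ltrDl divr_gt0// subr_gt0.
suff : S r by move/(ub_le_sup ubS); rewrite leNgt taur.
have r1 : r <= t1 by rewrite ge_min lexx.
split; first by rewrite r1 (le_trans tau0 (ltW taur)).
move=> s /andP[s0 sr]; have [st|ts] := leP s tau.
  by move: st; rewrite le_eqVlt => /predU1P[->//|]; exact: below.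
have h1 := KP tau s tau0 (ltW ts) (le_trans sr r1).
have h3 : K * (s - tau) <= c - h tau.
  rewrite mulrC -ler_pdivlMr// lerBlDl (le_trans sr)//.
  by rewrite ge_min lexx orbT.
have := ler_norm (h s - h tau); lra.
Qed.

(** Supplies the regularity hypothesis of [lipschitz_barrier] for the norm of a state. *)
Lemma vint_lipschitz k (X w : sgn R k) (X0 : 'cV[R]_k) (b : R) : mxlocbm w ->
  (forall t, 0 <= t -> X t = X0 + vint w 0 t) ->
  exists K, forall s t, 0 <= s -> s <= t -> t <= b ->
    `|inorm (X t) - inorm (X s)| <= K * (t - s).
Proof.
move=> ow EX; have [K [K0 KP]] := mxlocbm_bounded b ow.
exists K => s t s0 st tb.
have XK : inorm (X t - X s) <= K * (t - s).
  rewrite !EX//; last exact: le_trans st.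
  rewrite opprD addrACA subrr add0r vint_sub// -Rint_cst//.
  apply: vint_inorm_le => //; first exact: locbm_cst.
  by move=> r /andP[sr rt]; rewrite KP// (le_trans s0 sr) (le_trans rt).
have h1 := inormD (X t - X s) (X s); have h2 := inormD (X s - X t) (X t).
rewrite !subrK in h1 h2; rewrite (inormB (X s)) in h2.
rewrite ler_norml; apply/andP; split; lra.
Qed.

End SignalRegularity.

(** * The filter, the sampling matrix and the pseudo-inverse *)

Section ControllerLemmas.
Variable R : realType.
Local Notation mu := (@lebesgue_measure R).

Lemma hurwitz_NKf m (kf : 'I_m -> R) : (forall j, 0 < kf j) -> hurwitz (- Kf kf).
Proof.
move=> kf0 a b x y; rewrite -negb_and => xy0.
move=> /colP Ax /colP Ay.
have e i : - kf i * x i 0 = a * x i 0 - b * y i 0.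
  have := Ax i; rewrite mulNmx /Kf mul_diag_mx !mxE => <-.
  by rewrite mulNr.
have e' i : - kf i * y i 0 = b * x i 0 + a * y i 0.
  have := Ay i; rewrite mulNmx /Kf mul_diag_mx !mxE => <-.
  by rewrite mulNr.
rewrite ltNge; apply: contra xy0 => a0.
have xy i : x i 0 = 0 /\ y i 0 = 0.
  (* Adding [x i 0] times one eigenvector equation to [y i 0] times the other eliminates [b]. *)
  have h : (kf i + a) * (x i 0 ^+ 2 + y i 0 ^+ 2) = 0.
    rewrite (_ : _ * _ = - (x i 0 * (- kf i * x i 0 - (a * x i 0 - b * y i 0)) +
      y i 0 * (- kf i * y i 0 - (b * x i 0 + a * y i 0)))); last by ring.
    by rewrite e e' !subrr !mulr0 addr0 oppr0.
  have /eqP := h; rewrite mulf_eq0 gt_eqF ?ltr_pwDl//= paddr_eq0 ?sqr_ge0//.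
  by rewrite !sqrf_eq0 => /andP[/eqP ? /eqP].
by apply/andP; split; apply/eqP/colP => i; rewrite mxE; have [] := xy i.
Qed.

Lemma unitmx_colP k (A : 'M[R]_k) :
  (forall x : 'cV[R]_k, A *m x = 0 -> x = 0) -> A \in unitmx.
Proof.
move=> A0; rewrite -unitmx_tr -row_free_unit -kermx_eq0.
apply/eqP/row_matrixP => i; rewrite row0; apply: trmx_inj; rewrite trmx0.
apply: A0; apply: trmx_inj.
by rewrite trmx_mul trmxK -row_mul mulmx_ker row0 trmx0.
Qed.

Lemma hurwitz_unit k (A : 'M[R]_k) : hurwitz A -> A \in unitmx.
Proof.
move=> hA; apply: unitmx_colP => x Ax; apply/eqP/negPn/negP => x0.
have := hA 0 0 x 0; rewrite x0 mulmx0 Ax !scale0r subr0 addr0 ltxx.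
by move=> /(_ isT erefl erefl).
Qed.

(* A vector fixed by [expmx (T *: A)] is fixed by all the powers of that matrix,
   which tend to 0. *)
Lemma hurwitz_PhiT_unit k (A : 'M[R]_k) (T : R) : hurwitz A -> 0 < T ->
  PhiT A T \in unitmx.
Proof.
move=> hA T0; rewrite /PhiT unitmx_mul unitmx_inv hurwitz_unit//=.
apply: unitmx_colP => x; rewrite mulmxBl mul1mx => /eqP; rewrite subr_eq0 => /eqP Ex.
have EN (N : nat) : expmx ((N%:R * T) *: A) *m x = x.
  elim: N => [|N IH]; first by rewrite mul0r expmx0 mul1mx.
  by rewrite -natr1 mulrDl mul1r expmxD -mulmxA Ex.
apply/colP => i; rewrite mxE.
have cE j : (fun N : nat => expmx ((N%:R * T) *: A) i j) @ \oo --> (0 : R).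
  have [C [e [e0 C0 EC]]] := expdecay_bound (hurwitz_expdecay i j hA).
  have q1 : `|expR (- e * T)| < 1.
    by rewrite ger0_norm ?expR_ge0// expR_lt1 nmulr_rlt0 ?oppr_lt0.
  have lim0 : (fun N : nat => C * expR (- e * T) ^+ N) @ \oo --> (0 : R).
    rewrite -(mulr0 C); apply: cvgM; [exact: cvg_cst|exact: cvg_expr].
  have lim0' : (fun N : nat => - (C * expR (- e * T) ^+ N)) @ \oo --> (0 : R).
    by rewrite -oppr0; exact: cvgN.
  apply: (squeeze_cvgr _ lim0' lim0); near=> N.
  rewrite -ler_norml (le_trans (EC _ _)) ?mulr_ge0 ?(ltW T0)//.
  by rewrite -expRM_natl mulrCA.
have c1 : (fun N : nat => (expmx ((N%:R * T) *: A) *m x) i 0) @ \oo --> (0 : R).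
  rewrite (_ : (fun N => _) =
      fun N : nat => \sum_j expmx ((N%:R * T) *: A) i j * x j 0).
    rewrite -[X in _ --> X](_ : \sum_(j < k) 0 * x j 0 = 0); last first.
      by rewrite big1// => j _; rewrite mul0r.
    by apply: cvg_sumr => j; apply: cvgM; [exact: cE|exact: cvg_cst].
  by apply/funext => N; rewrite mxE.
have c2 : (fun N : nat => (expmx ((N%:R * T) *: A) *m x) i 0) @ \oo --> x i 0.
  rewrite (_ : (fun N => _) = fun=> x i 0); first exact: cvg_cst.
  by apply/funext => N; rewrite EN.
exact: (cvg_unique _ c2 c1).
Unshelve. all: by end_near. Qed.

(** In r, - A^{-1} e^{(t-r)A} is an antiderivative of e^{(t-r)A}; it is integrated by parts against
    the constant [y], a primitive of 0. So [PhiT] is the response to a constant estimate, which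
    explains its inverse in the adaptive law. *)
Lemma vint_expmx k (A : 'M[R]_k) (y : 'cV[R]_k) (s t : R) : A \in unitmx ->
  0 <= s -> s <= t ->
  vint (fun r => expmx ((t - r) *: A) *m y) s t = PhiT A (t - s) *m y.
Proof.
move=> uA s0 st.
pose G r := - invmx A *m expmx ((t - r) *: A); pose G' r := expmx ((t - r) *: A).
have cG' i j : continuous (fun r => G' r i j) by exact: continuous_expmx_reflect.
have dG i j (r : R) : is_derive r 1 (fun r => G r i j) (G' r i j).
  have := @is_derive_mulmxl _ _ _ _ (- invmx A) G'
    (fun r => - (A *m G' r)) _ i j r.
  rewrite mulmxN mulNmx opprK mulmxA mulVmx// mul1mx; apply => p q x.
  rewrite mxE; apply: (@is_derive_reflect _ (fun x => expmx (x *: A) p q)).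
  exact: is_derive_expmx_entry.
have Ey r : 0 <= r -> y = y + vint (fun=> 0 : 'cV[R]_k) 0 r.
  move=> r0; rewrite [X in _ + X](_ : _ = 0) ?addr0//.
  by apply/colP => i; rewrite !mxE -[RHS](mul0r (r - 0)) -Rint_cst//;
     apply: eq_Rintegral => x _; rewrite mxE.
have := vint_by_parts cG' dG (mxlocbm_cst (0 : 'cV[R]_k)) Ey s0 st.
rewrite /G subrr expmx0 mulmx1 -mulmxBl.
rewrite (_ : vint _ s t = vint (fun r => expmx ((t - r) *: A) *m y) s t).
  by move=> ->; rewrite /PhiT mulmxBr mulmx1 mulNmx opprK addrC.
by apply: eq_vint => r _; rewrite mulmx0 addr0.
Qed.

(** The reflected integral depends only on the length [t - s], which makes it monotone in that
    length. *)
Lemma Rint_inorm_expmx k l (A : 'M[R]_k) (M : 'M[R]_(k, l)) (s t : R) : s <= t ->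
  \int[mu]_(r in `[s, t]) inorm (expmx ((t - r) *: A) *m M) =
  \int[mu]_(r in `[0, t - s]) inorm (expmx (r *: A) *m M).
Proof.
move=> st; have := @Rint_reflect _ (fun r => inorm (expmx (r *: A) *m M)) t s t.
rewrite subrr; apply => //.
apply: continuous_inorm; apply: continuous_mulmxr.
exact: continuous_expmx_entry.
Qed.

Lemma locbm_inorm_expmx k l (A : 'M[R]_k) (M : 'M[R]_(k, l)) :
  locbm (fun r => inorm (expmx (r *: A) *m M)).
Proof.
apply/continuous_locbm/continuous_inorm/continuous_mulmxr.
exact: continuous_expmx_entry.
Qed.

Lemma locbm_inorm_expmx_reflect k l (A : 'M[R]_k) (M : 'M[R]_(k, l)) (t : R) :
  locbm (fun r => inorm (expmx ((t - r) *: A) *m M)).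
Proof.
apply/continuous_locbm/continuous_inorm/continuous_mulmxr.
exact: continuous_expmx_reflect.
Qed.

Lemma Rint_inorm_expmx_mono k l (A : 'M[R]_k) (M : 'M[R]_(k, l)) (s t : R) :
  0 <= s -> s <= t ->
  \int[mu]_(r in `[0, s]) inorm (expmx (r *: A) *m M) <=
  \int[mu]_(r in `[0, t]) inorm (expmx (r *: A) *m M).
Proof.
move=> s0 st; rewrite -subr_ge0 (Rint_sub (locbm_inorm_expmx A M))//.
by apply: Rintegral_ge0 => r _; exact: inorm_ge0.
Qed.

Lemma vint_expmx_bound k l (A : 'M[R]_k) (M : 'M[R]_(k, l)) (g : sgn R l)
    (c s t : R) : mxlocbm g -> 0 <= s -> s <= t ->
  (forall r, s <= r <= t -> inorm (g r) <= c) ->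
  inorm (vint (fun r => expmx ((t - r) *: A) *m M *m g r) s t) <=
  c * \int[mu]_(r in `[0, t - s]) inorm (expmx (r *: A) *m M).
Proof.
move=> og s0 st gc; rewrite -Rint_inorm_expmx// -RintZl//; last first.
  exact: locbm_inorm_expmx_reflect.
apply: vint_inorm_le => //; first exact: mxlocbm_lti_integrand.
  by apply: locbmM; [exact: locbm_cst|exact: locbm_inorm_expmx_reflect].
move=> r rst; rewrite (le_trans (inorm_mulmx _ _))// mulrC.
by rewrite ler_wpM2r ?inorm_ge0// gc.
Qed.

(** The estimate is constant on half-open periods only; its jump at the right end must be
    ignored. *)
Lemma eq_vint_co a (f g : R -> 'cV[R]_a) (s t : R) : mxlocbm f -> mxlocbm g ->
  0 <= s -> (forall r, s <= r < t -> f r = g r) -> vint f s t = vint g s t.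
Proof.
move=> of_ og s0 fg; apply/colP => i; rewrite !mxE.
have iS h : locbm h -> mu.-integrable `[s, t[ (EFin \o h).
  move=> oh; apply: integrableS (locbm_integrable t oh s0) => //.
  by apply: subset_itvl; rewrite bnd_simp.
rewrite -(Rintegral_itv_bndo_bndc (iS _ (of_ i 0))).
rewrite -(Rintegral_itv_bndo_bndc (iS _ (og i 0))).
by apply: eq_Rintegral => r; rewrite inE/= in_itv/= => /fg ->.
Qed.

(** By orthogonality the Gram matrix of [row_mx B Bp] is block diagonal; being invertible, it has an
    invertible block [B^T *m B]. *)
Lemma pinv_row_mx m p (B : 'M[R]_(m + p, m)) (Bp : 'M[R]_(m + p, p)) :
  Bp^T *m B = 0 -> row_mx B Bp \in unitmx ->
  pinv B *m B = 1%:M /\ pinv B *m Bp = 0.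
Proof.
move=> BpB uB.
have BBp : B^T *m Bp = 0 by apply: trmx_inj; rewrite trmx_mul trmxK BpB trmx0.
have uBB : B^T *m B \in unitmx.
  have : (row_mx B Bp)^T *m row_mx B Bp \in unitmx.
    by rewrite unitmx_mul unitmx_tr uB.
  rewrite tr_row_mx mul_col_row BBp BpB unitmxE det_ublock unitrM.
  by case/andP.
by rewrite /pinv -!mulmxA BBp mulmx0 mulVmx.
Qed.

(** * The prediction error under the sampled adaptive law *)

Section PredictionError.
Variables (n m : nat) (Ae : 'M[R]_n) (B : 'M[R]_(n, m)) (T bf : R).
Variables (e sigma : sgn R n) (g : sgn R m) (t : R).
Hypotheses (hAe : hurwitz Ae) (T0 : 0 < T).
Hypotheses (oe : mxlocbm e) (os : mxlocbm sigma) (og : mxlocbm g).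
Hypothesis Ee : forall r, 0 <= r ->
  e r = vint (fun x => Ae *m e x + (sigma x - B *m g x)) 0 r.
Hypothesis sampled : forall (i : nat) r, i%:R * T <= r < i.+1%:R * T ->
  sigma r = - (invmx (PhiT Ae T) *m expmx (T *: Ae) *m e (i%:R * T)).
Hypothesis gbf : forall s, 0 <= s <= t -> inorm (g s) <= bf.

(** Here [sigma] stands for [row_mx B Bp *m sh], which is why [sampled] shows no inverse of
    [row_mx B Bp]. *)
Lemma prediction_error_voc (a s : R) : 0 <= a -> a <= s ->
  e s = expmx ((s - a) *: Ae) *m e a +
    (vint (fun r => expmx ((s - r) *: Ae) *m sigma r) a s -
     vint (fun r => expmx ((s - r) *: Ae) *m B *m g r) a s).
Proof.
move=> a0 as_; have oE := mxlocbm_expmx_reflect Ae s.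
rewrite -vintB//; last 2 first.
- exact: mxlocbmM.
- exact: mxlocbm_lti_integrand.
rewrite (@variation_of_constants _ _ Ae e (fun r => sigma r - B *m g r) 0 a s)//.
- by congr (_ + _); apply: eq_vint => r _; rewrite mulmxBr mulmxA.
- by apply: mxlocbmB => //; exact: mxlocbmMl.
- by move=> r /Ee ->; rewrite add0r.
Qed.

Lemma alpha0E : alpha0 Ae B T =
  \int[mu]_(r in `[0, T]) inorm (expmx (r *: Ae) *m B).
Proof. by rewrite /alpha0 Rint_inorm_expmx ?subr0// ltW. Qed.

(** Over a full period the constant estimate [y] contributes [PhiT Ae T *m y = - expmx (T *: Ae) *m
    e a], the opposite of the propagated error. Only the uncertainty of the last period is left,
    whence [alpha0]. *)
Lemma prediction_error_sample (i : nat) : 0 <= bf -> i%:R * T <= t ->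
  inorm (e (i%:R * T)) <= bf * alpha0 Ae B T.
Proof.
move=> bf0; case: i => [_|i it].
  rewrite mul0r Ee// vintxx inorm0 mulr_ge0// alpha0E.
  by apply: Rintegral_ge0 => r _; exact: inorm_ge0.
set a := i%:R * T; set b := i.+1%:R * T.
have a0 : 0 <= a by rewrite mulr_ge0// ltW.
have ba : b - a = T by rewrite /b -natr1 mulrDl mul1r addrC addKr.
have ab : a <= b by rewrite -subr_ge0 ba ltW.
have oE := mxlocbm_expmx_reflect Ae b.
rewrite (prediction_error_voc a0 ab) ba.
pose y := - (invmx (PhiT Ae T) *m expmx (T *: Ae) *m e a).
rewrite (@eq_vint_co _ _ (fun r => expmx ((b - r) *: Ae) *m y) a b)//; last 3 first.
- exact: mxlocbmM.
- by apply: mxlocbmM => //; exact: mxlocbm_cst.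
- by move=> r rab; rewrite (@sampled i).
rewrite vint_expmx ?hurwitz_unit// ba /y mulmxN -[invmx _ *m _ *m _]mulmxA mulKVmx; last first.
  exact: hurwitz_PhiT_unit.
rewrite addrA subrr add0r inormN alpha0E -ba.
apply: vint_expmx_bound => // r /andP[ar rb].
by rewrite gbf// (le_trans a0 ar) (le_trans rb it).
Qed.

(** Since the last sampling time [a], three terms add up: the propagated error [e a], the constant
    estimate computed from [e a], and the uncertainty. With [e a] at most [bf * alpha0], they give
    the summands [alpha1], [alpha2] and 1 of [gamma0]. *)
Lemma prediction_error_bound : 0 <= t -> inorm (e t) <= gamma0 Ae B T bf.
Proof.
move=> t0.
have bf0 : 0 <= bf by apply: le_trans (gbf (s := 0) _); rewrite ?inorm_ge0 ?lexx.
pose i := Num.truncn (t / T); pose a := i%:R * T.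
have /andP[it ti] : i%:R * T <= t < i.+1%:R * T.
  have /truncn_itv : 0 <= t / T by rewrite divr_ge0// ltW.
  by rewrite ler_pdivlMr// ltr_pdivrMr.
have a0 : 0 <= a by rewrite mulr_ge0// ltW.
have taT : t - a <= T by rewrite lerBlDr addrC -[X in _ + X]mul1r -mulrDl natr1 ltW.
have ta0 : 0 <= t - a by rewrite subr_ge0.
have ea := prediction_error_sample bf0 it.
have A00 : 0 <= alpha0 Ae B T.
  by rewrite alpha0E; apply: Rintegral_ge0 => r _; exact: inorm_ge0.
have ea0 : 0 <= bf * alpha0 Ae B T by exact: mulr_ge0.
pose M := invmx (PhiT Ae T) *m expmx (T *: Ae).
have a1 : inorm (expmx ((t - a) *: Ae)) <= alpha1 Ae T.
  rewrite /alpha1; apply: ub_le_sup; last first.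
    by exists (t - a) => //=; rewrite in_itv/= ta0.
  have [_ [K KP]] := locbm_inorm_expmx Ae 1 T.
  exists K => _ [s /= + <-]; rewrite in_itv/= => sT.
  by have := KP s sT; rewrite mulmx1 ger0_norm ?inorm_ge0.
(* In reflected form the integrals of [alpha2] increase with [s], so the value at [T] bounds the set
   whose [sup] is taken. *)
have E2 s : 0 <= s -> \int[mu]_(r in `[0, s])
    inorm (expmx ((s - r) *: Ae) *m invmx (PhiT Ae T) *m expmx (T *: Ae)) =
    \int[mu]_(r in `[0, s]) inorm (expmx (r *: Ae) *m M).
  move=> s0; have := @Rint_inorm_expmx _ _ Ae M 0 s s0; rewrite subr0 => <-.
  by apply: eq_Rintegral => r _; rewrite mulmxA.
have a2 : \int[mu]_(r in `[0, t - a]) inorm (expmx (r *: Ae) *m M) <= alpha2 Ae T.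
  rewrite -E2// /alpha2; apply: ub_le_sup.
    exists (\int[mu]_(r in `[0, T]) inorm (expmx (r *: Ae) *m M)).
    move=> _ [s /= + <-]; rewrite in_itv/= => /andP[s0 sT].
    by rewrite E2// Rint_inorm_expmx_mono.
  by exists (t - a) => //=; rewrite in_itv/= ta0.
have g2 : inorm (vint (fun r => expmx ((t - r) *: Ae) *m sigma r) a t) <=
    bf * alpha0 Ae B T * alpha2 Ae T.
  rewrite (@eq_vint _ _ _ (fun r => expmx ((t - r) *: Ae) *m M *m (- e a))).
    apply: le_trans (_ : _ <= bf * alpha0 Ae B T *
      \int[mu]_(r in `[0, t - a]) inorm (expmx (r *: Ae) *m M)) _.
      apply: vint_expmx_bound => //; first exact: mxlocbm_cst.
      by move=> r _; rewrite inormN.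
    by rewrite ler_wpM2l.
  move=> r /andP[ar rt]; rewrite (@sampled i) ?ar ?(le_lt_trans rt)//.
  by rewrite /M !mulmxN !mulmxA.
have g3 : inorm (vint (fun r => expmx ((t - r) *: Ae) *m B *m g r) a t) <=
    bf * alpha0 Ae B T.
  apply: le_trans (_ : _ <= bf *
    \int[mu]_(r in `[0, t - a]) inorm (expmx (r *: Ae) *m B)) _.
    apply: vint_expmx_bound => // r /andP[ar rt].
    by rewrite gbf// (le_trans a0 ar).
  apply: ler_wpM2l; first exact: bf0.
  by rewrite alpha0E; exact: Rint_inorm_expmx_mono.
rewrite (prediction_error_voc a0 it) /gamma0 !mulrDr mulr1 -addrA.
rewrite (le_trans (inormD _ _))// lerD//.
  rewrite (le_trans (inorm_mulmx _ _))// mulrC.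
  by rewrite ler_pM ?inorm_ge0.
by rewrite (le_trans (inormD _ _))// inormN lerD.
Qed.

End PredictionError.

(* Integrating by parts trades the derivative of the prediction error for the
   direct feedthrough term of [CBsAe]. *)
Lemma filt_prediction_error m p (B : 'M[R]_(m + p, m)) (Bp : 'M[R]_(m + p, p))
    (Ae : 'M[R]_(m + p)) (kf : 'I_m -> R) (e sh : sgn R (m + p)) (g : sgn R m)
    (t : R) :
  Bp^T *m B = 0 -> row_mx B Bp \in unitmx ->
  mxlocbm e -> mxlocbm sh -> mxlocbm g ->
  (forall r, 0 <= r ->
    e r = vint (fun x => Ae *m e x + (row_mx B Bp *m sh x - B *m g x)) 0 r) ->
  0 <= t ->
  filt kf (fun r => usubmx (sh r) - g r) t = CBsAe B Ae kf e t.
Proof.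
move=> BpB uB oe os og Ee t0; have [PB PBp] := pinv_row_mx BpB uB.
set P := pinv B in PB PBp *; set K := Kf kf.
have ou : mxlocbm (fun r => usubmx (sh r)).
  by move=> i j; apply: locbm_ext (os (lshift p i) j) => r _; rewrite mxE.
(* Multiplying the error equation by the pseudo-inverse kills [Bp] and exhibits the filter input as
   the derivative of [P *m e] minus [P *m Ae *m e]. *)
have Pw x : P *m (Ae *m e x + (row_mx B Bp *m sh x - B *m g x)) =
    P *m Ae *m e x + (usubmx (sh x) - g x).
  rewrite mulmxDr mulmxBr !mulmxA mul_mx_row PB PBp mul1mx; congr (_ + (_ - _)).
  by rewrite -{1}[sh x]vsubmxK mul_row_col mul1mx mul0mx addr0.
pose w x := P *m Ae *m e x + (usubmx (sh x) - g x).
have ow : mxlocbm w.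
  by apply: mxlocbmD; [exact: mxlocbmMl|exact: mxlocbmB].
have Ez r : 0 <= r -> P *m e r = 0 + vint w 0 r.
  move=> r0; rewrite add0r Ee// mulmx_vint//.
    by apply: eq_vint => x _; rewrite Pw.
  apply: mxlocbmD; first exact: mxlocbmMl.
  by apply: mxlocbmB; exact: mxlocbmMl.
pose E r := expmx ((t - r) *: - K).
pose G r := E r *m K; pose G' r := K *m E r *m K.
have cE i j : continuous (fun r => E r i j) by exact: continuous_expmx_reflect.
have cG' i j : continuous (fun r => G' r i j).
  by apply: continuous_mulmxr; exact: continuous_mulmxl.
have KE r : K *m E r = E r *m K.
  by apply: oppr_inj; rewrite -mulNmx -mulmxN expmx_comm.
have dG i j (r : R) : is_derive r 1 (fun r => G r i j) (G' r i j).
  rewrite (_ : (fun r => G r i j) = fun r => (K *m E r) i j); last first.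
    by apply/funext => x; rewrite KE.
  rewrite /G' -mulmxA -KE.
  apply: (@is_derive_mulmxl _ _ _ _ K E (fun r => K *m E r)) => {}i {}j x.
  have := @is_derive_reflect _ (fun x => expmx (x *: - K) i j) t x _
    (is_derive_expmx_entry (- K) (t - x) i j).
  by rewrite mulNmx mxE opprK.
have oE : mxlocbm E by exact: mxlocbm_expmx_reflect.
have e0 : P *m e 0 = 0 by rewrite Ez// vintxx addr0.
have := vint_by_parts cG' dG ow Ez (lexx 0) t0.
rewrite e0 mulmx0 subr0 /G /E subrr expmx0 mul1mx -/(E _) => H.
rewrite /filt /CBsAe /lti -/K -/P mul1mx mul0mx addr0 -mulmxA -H.
rewrite mulNmx mul1mx -vintN//; last exact: mxlocbm_lti_integrand.
rewrite -vintD//; last 2 first.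
- apply: mxlocbmN; exact: mxlocbm_lti_integrand.
- apply: mxlocbmD; apply: mxlocbmM => //.
  + by apply: mxlocbmM; [exact: mxlocbmMl|exact: mxlocbm_cst].
  + exact: mxlocbmMl.
  + by apply: mxlocbmM => //; exact: mxlocbm_cst.
apply: eq_vint => r _; rewrite -/(E r) /G' /w KE.
have -> : E r *m (K *m (K *m P + P *m Ae)) *m e r =
    E r *m K *m K *m (P *m e r) + E r *m K *m (P *m Ae *m e r).
  by rewrite !mulmxDr mulmxDl !mulmxA.
by rewrite [E r *m K *m (_ + (_ - _))]mulmxDr [X in _ = _ + X]addrA addKr.
Qed.

End ControllerLemmas.

(** * Bounds on the data and the closed-loop estimates *)

Lemma compact_inorm_ubound (R : realType) k (X : set 'cV[R]_k) : compact X ->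
  has_ubound [set inorm z | z in X].
Proof.
move=> cX.
have /choice[m mP] : forall i, exists M, forall z, X z -> `|z i 0| <= M.
  move=> i; have ci : {within X, continuous (fun z : 'cV[R]_k => z i 0)}.
    by apply: continuous_subspaceT => z; exact: coord_continuous.
  have /compact_bounded[M [_ MP]] := continuous_compact ci cX.
  exists (M + 1) => z Xz; apply: MP; first by rewrite ltrDl.
  by exists z.
exists (\sum_i `|m i|) => _ [z Xz <-].
apply: inorm_col_le => [|i]; first by apply: sumr_ge0.
rewrite (le_trans (mP i z Xz))// (le_trans (ler_norm _))//.
by rewrite (bigD1 i)//= lerDl; apply: sumr_ge0.
Qed.

Lemma maxj_ge0 (R : realType) m (c : 'I_m -> R) : 0 <= maxj c.
Proof. exact: bigmax_ge_id. Qed.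

Lemma f_consts_inorm_le (R : realType) n m (f : R -> 'cV[R]_n -> 'cV[R]_m) Z
    (L l b : 'I_m -> R) (t : R) x :
  f_consts f Z L l b -> 0 <= t -> Z x -> inorm (f t x) <= maxj b.
Proof.
move=> [_ fb] t0 Zx; apply: inorm_col_le => [|j]; first exact: maxj_ge0.
by rewrite (le_trans (fb j t x t0 Zx))//; exact: (le_bigmax _ b).
Qed.

Lemma f_consts_inorm_lip (R : realType) n m (f : R -> 'cV[R]_n -> 'cV[R]_m) Z
    (L l b : 'I_m -> R) (t : R) x z :
  f_consts f Z L l b -> 0 <= t -> Z x -> Z z ->
  inorm (f t x - f t z) <= maxj L * inorm (x - z).
Proof.
move=> [fL _] t0 Zx Zz; apply: inorm_col_le => [|j].
  by rewrite mulr_ge0 ?inorm_ge0 ?maxj_ge0.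
rewrite !mxE (le_trans (fL j t t x z t0 t0 Zx Zz))// subrr normr0 mulr0 addr0.
by rewrite ler_wpM2r ?inorm_ge0//; exact: (le_bigmax _ L).
Qed.

(** The free response is the response of s (sI - Am)^{-1} to the constant input [x0]; this is how
    [rho_in] comes to bound it. *)
Lemma sHm_cst (R : realType) n (Am : 'M[R]_n) (x0 : 'cV[R]_n) (t : R) :
  Am \in unitmx -> 0 <= t -> sHm Am (fun=> x0) t = expmx (t *: Am) *m x0.
Proof.
move=> uA t0; rewrite /sHm /lti mul1mx.
rewrite (@eq_vint _ _ _ (fun r => expmx ((t - r) *: Am) *m x0)) => [|r _].
  by rewrite vint_expmx// subr0 /PhiT mulmxA mulKVmx// mulmxBl mul1mx subrK.
by rewrite mulmx1.
Qed.

Lemma HxmE (R : realType) n m (Am : 'M[R]_n) (B : 'M[R]_(n, m)) (u : sgn R m)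
    (t : R) :
  Hxm Am B u t = vint (fun r => expmx ((t - r) *: Am) *m (B *m u r)) 0 t.
Proof.
rewrite /Hxm /lti mul1mx mul0mx addr0.
by apply: eq_vint => r _; rewrite mulmxA.
Qed.

(* state dimension n = m + p  (p = n - m, B^perp is n x p) *)
Theorem theorem1 (R : realType) (m p : nat)
  (Am : 'M[R]_(m + p)) (B Bv : 'M[R]_(m + p, m)) (Bp : 'M[R]_(m + p, p))
  (Ae : 'M[R]_(m + p)) (kf : 'I_m -> R) (T : R)
  (v : sgn R m) (X0 : set 'cV[R]_(m + p)) (x0 : 'cV[R]_(m + p))
  (f : R -> 'cV[R]_(m + p) -> 'cV[R]_m)
  (rho_r gamma1 : R)
  (L l b : 'I_m -> R)        (* constants of f on Omega(rho) *)
  (Lr lr br : 'I_m -> R)     (* constants of f on Omega(rho_r) *)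
  (x xh sh : sgn R (m + p)) (ua : sgn R m)
  (xr : sgn R (m + p)) (ur : sgn R m) :
  (* standing setup *)
  hurwitz Am -> \rank B = m ->
  bounded_sig v -> pw_cont v ->
  compact X0 -> x0 \in X0 ->
  (forall Z : set 'cV[R]_(m + p), compact Z ->
     exists L0 l0 b0 : 'I_m -> R, f_consts f Z L0 l0 b0) ->
  (forall j, 0 < kf j) ->
  hurwitz Ae -> Bp^T *m B = 0 -> row_mx B Bp \in unitmx -> 0 < T ->
  (* the adaptive closed-loop system and its (unique continuous) solution *)
  adaptive_sol Am Bv B Bp Ae kf T v f x0 x xh sh ua ->
  (forall x' xh' sh' ua', adaptive_sol Am Bv B Bp Ae kf T v f x0 x' xh' sh' ua' ->
     forall t, 0 <= t -> x' t = x t /\ xh' t = xh t) ->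
  (* the reference system and its (unique continuous) solution *)
  ref_sol Am Bv B kf v f x0 xr ur ->
  (forall xr' ur', ref_sol Am Bv B kf v f x0 xr' ur' ->
     forall t, 0 <= t -> xr' t = xr t) ->
  (* theorem hypotheses *)
  0 < rho_r -> 0 < gamma1 ->
  let rho := rho_r + gamma1 in
  f_consts f (Omega (k:=m + p) rho) L l b ->
  f_consts f (Omega (k:=m + p) rho_r) Lr lr br ->
  let Lf := maxj L in
  let bf := maxj b in
  let bf_r := maxj br in
  let rho_in := L1norm (sHm Am) * sup [set inorm z | z in X0] in
  let g0 := gamma0 Ae B T bf in
  L1norm (Gxm Am B kf) * bf_r
    < rho_r - L1norm (Hxm Am Bv) * Linf v - rho_in ->
  L1norm (Gxm Am B kf) * Lf < 1 ->
  L1norm (HxmCBsAe Am B Ae kf) / (1 - L1norm (Gxm Am B kf) * Lf) * g0 < gamma1 ->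
  let gamma2 := L1norm (filt kf) * Lf * gamma1 + L1norm (CBsAe B Ae kf) * g0 in
  let rho_ua := L1norm (filt kf) * bf_r + gamma2 in
  (forall t, 0 <= t -> inorm (x t) <= rho) /\
  (forall t, 0 <= t -> inorm (ua t) <= rho_ua) /\
  (forall t, 0 <= t -> inorm (xr t - x t) <= gamma1) /\
  (forall t, 0 <= t -> inorm (ur t - ua t) <= gamma2).
Proof.
move=> hAm _ bv pv cX0 x0X fZ kf0 hAe BpB uB T0.
move=> [cx [cxh [Ex [Exh [Esh Eua]]]]] _ [cxr [Exr Eur]] _ rr0 g10 rho fc fcr.
move=> Lf bf bf_r rho_in g0 C1 C2 C3 gamma2 rho_ua.
have ox := within_ge0_mxlocbm cx; have oxh := within_ge0_mxlocbm cxh.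
have oxr := within_ge0_mxlocbm cxr; have ov := pw_cont_mxlocbm bv pv.
have osh : mxlocbm sh := sampled_mxlocbm T0 Esh.
pose s1 r := usubmx (sh r).
have os1 : mxlocbm s1.
  by move=> i j; apply: locbm_ext (osh (lshift p i) j) => r _; rewrite mxE.
pose F r := f r (x r); pose Fr r := f r (xr r).
have oF : mxlocbm F by exact: feedback_mxlocbm.
have oFr : mxlocbm Fr by exact: feedback_mxlocbm.
have hK := hurwitz_NKf kf0.
have sC : stable_op (filt kf) by exact: lti_stable.
have sH : stable_op (Hxm Am B) by exact: lti_stable.
have sHv : stable_op (Hxm Am Bv) by exact: lti_stable.
have sG : stable_op (Gxm Am B kf) := stable_comp sH (stable_idB sC).
have sCB : stable_op (CBsAe B Ae kf) by exact: lti_stable.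
have sHCB : stable_op (HxmCBsAe Am B Ae kf) := stable_comp sH sCB.
have sS : stable_op (sHm Am) by exact: lti_stable.
have oua : mxlocbm ua.
  apply: mxlocbm_ext (mxlocbmN (stable_mxlocbm sC os1)) => r r0.
  by rewrite Eua.
have our : mxlocbm ur.
  apply: mxlocbm_ext (mxlocbmN (stable_mxlocbm sC oFr)) => r r0.
  by rewrite Eur.
have G0 := L1norm_ge0 sG.
have Lf0 : 0 <= Lf by exact: maxj_ge0.
have oB (u : sgn R m) : mxlocbm u -> mxlocbm (fun r => B *m u r).
  exact: mxlocbmMl.
have oW (y : sgn R (m + p)) (u g : sgn R m) : mxlocbm y -> mxlocbm u ->
    mxlocbm g -> mxlocbm (fun r => Am *m y r + Bv *m v r + B *m (u r + g r)).
  move=> oy ou og; apply: mxlocbmD; last by apply/oB/mxlocbmD.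
  by apply: mxlocbmD; exact: mxlocbmMl.
pose e r := xh r - x r.
have oe : mxlocbm e by exact: mxlocbmB.
have rsh r : row_mx B Bp *m sh r = B *m s1 r + Bp *m dsubmx (sh r).
  by rewrite -{1}[sh r]vsubmxK mul_row_col.
have Ee r : 0 <= r ->
    e r = vint (fun s => Ae *m e s + (row_mx B Bp *m sh s - B *m F s)) 0 r.
  move=> r0; rewrite /e Exh// Ex// opprD addrACA subrr add0r -vintB//.
  - apply: eq_vint => s _; rewrite rsh -/(e s) -/(F s) -/(s1 s) !mulmxDr.
    move: (Am *m _) (Bv *m _) (B *m ua s) (B *m s1 s) (Bp *m _) (Ae *m _) (B *m F s).
    move=> a1 a2 a3 a4 a5 a6 a7.
    by apply/matrixP => i j; rewrite !mxE; ring.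
  - apply: mxlocbmD; last by apply: mxlocbmMl.
    apply: mxlocbmD; first exact: oW.
    apply: mxlocbmMl => i j.
    by apply: locbm_ext (osh (rshift m i) j) => s _; rewrite mxE.
  - exact: oW.
have filtE r : 0 <= r -> filt kf (fun s => s1 s - F s) r = CBsAe B Ae kf e r.
  exact: (filt_prediction_error kf BpB uB oe osh oF Ee).
have eE r : 0 <= r -> (forall s, 0 <= s <= r -> inorm (F s) <= bf) ->
    inorm (e r) <= g0.
  move=> r0 Fb; apply: (@prediction_error_bound _ _ _ _ _ _ _ e
    (fun s => row_mx B Bp *m sh s) F) => //; first exact: mxlocbmMl.
  by move=> i s is_; rewrite (Esh i s is_) mulmxN !mulmxA mulmxV// mul1mx.
have Wxr r : 0 <= r -> xr r = expmx (r *: Am) *m x0 + Hxm Am Bv v r +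
    Gxm Am B kf Fr r.
  move=> r0.
  rewrite (@variation_of_constants _ _ Am xr
    (fun s => Bv *m v s + B *m (ur s + Fr s)) x0 0 r)//; last 2 first.
  - by apply: mxlocbmD; [exact: mxlocbmMl|apply/oB/mxlocbmD].
  - by move=> s s0; rewrite Exr//; congr (_ + _); apply: eq_vint => y _; rewrite addrA.
  have xr0 : xr 0 = x0 by rewrite Exr// vintxx addr0.
  rewrite subr0 xr0 -addrA; congr (_ + _); rewrite /Gxm !HxmE -vintD//; last 2 first.
  - by apply: mxlocbmM; [exact: mxlocbm_expmx_reflect|exact: mxlocbmMl].
  - apply: mxlocbmM; [exact: mxlocbm_expmx_reflect|apply: oB].
    by apply: mxlocbmB => //; exact: stable_mxlocbm.
  apply: eq_vint => s /andP[s0 _].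
  by rewrite mulmxDr Eur// [- _ + _]addrC.
have x0_in r : 0 <= r -> inorm (expmx (r *: Am) *m x0) <= rho_in.
  move=> r0; rewrite -(sHm_cst _ (hurwitz_unit hAm) r0).
  apply: (@le_trans _ _ (L1norm (sHm Am) * inorm x0)).
    by apply: L1norm_bound => //; exact: mxlocbm_cst.
  apply: ler_wpM2l; first exact: L1norm_ge0.
  apply: ub_le_sup; first exact: compact_inorm_ubound.
  by exists x0 => //; exact/set_mem.
have v_in r : 0 <= r -> inorm (v r) <= Linf v.
  move=> r0; apply: ub_le_sup; last by exists r.
  by have [M vM] := bv; exists M => _ [s /= s0 <-]; exact: vM.
have bfr0 : 0 <= bf_r by exact: maxj_ge0.
have xr_lt : forall r, 0 <= r -> inorm (xr r) < rho_r.
  apply: lipschitz_barrier.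
  - move=> b'; apply: vint_lipschitz Exr.
    exact: oW.
  (* [x0] is the free response at time 0, hence at most [rho_in], which (C1) places below
     [rho_r]. *)
  - have xr0 : xr 0 = x0 by rewrite Exr// vintxx addr0.
    have := x0_in 0 (lexx 0); rewrite expmx0 mul1mx xr0 => h.
    have := mulr_ge0 G0 bfr0.
    have Lv0 : 0 <= L1norm (Hxm Am Bv) * Linf v.
      rewrite mulr_ge0 ?L1norm_ge0// (le_trans (inorm_ge0 (v 0)))// v_in//.
    move=> h'; apply: (le_trans h); move: C1 h' Lv0; lra.
  - move=> r r0 xrs; rewrite Wxr//.
    have h1 := x0_in r r0.
    have h2 : inorm (Hxm Am Bv v r) <= L1norm (Hxm Am Bv) * Linf v.
      by apply: L1norm_bound => // s /andP[s0 _]; exact: v_in.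
    have h3 : inorm (Gxm Am B kf Fr r) <= L1norm (Gxm Am B kf) * bf_r.
      apply: L1norm_bound => // s /andP[s0 sr].
      by apply: (f_consts_inorm_le fcr s0); apply: xrs; rewrite s0.
    have h4 := inormD (expmx (r *: Am) *m x0 + Hxm Am Bv v r) (Gxm Am B kf Fr r).
    have h5 := inormD (expmx (r *: Am) *m x0) (Hxm Am Bv v r).
    move: C1 h1 h2 h3 h4 h5; lra.
pose d r := xr r - x r.
have od : mxlocbm d by exact: mxlocbmB.
(* Writing [s1 - Fr] as [(s1 - F) - (Fr - F)] separates the estimation error, expressed through [e]
   by [filtE], from the mismatch of the two states. *)
have uE r : 0 <= r -> ur r - ua r =
    CBsAe B Ae kf e r - filt kf (fun s => Fr s - F s) r.
  move=> r0; rewrite Eur// Eua// -filtE// /filt !ltiB// -/(filt _) opprK.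
  rewrite !opprB addrC addrA subrK//.
have Wd r : 0 <= r -> d r = Gxm Am B kf (fun s => Fr s - F s) r +
    HxmCBsAe Am B Ae kf e r.
  move=> r0.
  rewrite (@variation_of_constants _ _ Am d
    (fun s => B *m ((ur s - ua s) + (Fr s - F s))) 0 0 r)//; last 2 first.
  - by apply: oB; apply: mxlocbmD; exact: mxlocbmB.
  - move=> s s0; rewrite /d Exr// Ex// opprD addrACA subrr; congr (_ + _).
    rewrite -vintB//; try exact: oW.
    apply: eq_vint => y _; rewrite -/(F y) -/(Fr y) !mulmxDr !mulmxN.
    move: (Am *m xr y) (Am *m x y) (Bv *m _) (B *m ua y) (B *m ur y) (B *m F y)
      (B *m Fr y) => a1 a2 a3 a4 a5 a6 a7.
    by apply/matrixP => i j; rewrite !mxE; ring.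
  have d0 : d 0 = 0 by rewrite /d Exr// Ex// !vintxx subrr.
  rewrite d0 mulmx0 add0r /Gxm /HxmCBsAe !HxmE -vintD//; last 2 first.
  - apply: mxlocbmM; [exact: mxlocbm_expmx_reflect|apply: oB].
    apply: mxlocbmB; first exact: mxlocbmB.
    by apply: (stable_mxlocbm sC); exact: mxlocbmB.
  - apply: mxlocbmM; [exact: mxlocbm_expmx_reflect|apply: oB].
    exact: (stable_mxlocbm sCB).
  apply: eq_vint => s /andP[s0 _]; rewrite uE// -mulmxDr -mulmxDr.
  by congr (_ *m (_ *m _)); rewrite addrC addrA addrAC.
have x_le r : 0 <= r -> inorm (d r) <= gamma1 -> inorm (x r) <= rho.
  move=> r0 dr; have -> : x r = xr r - d r by rewrite /d subKr.
  rewrite (le_trans (inormD _ _))// inormN.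
  by apply: lerD => //; exact/ltW/xr_lt.
have e_le r : 0 <= r -> (forall s, 0 <= s <= r -> inorm (d s) <= gamma1) ->
    inorm (e r) <= g0.
  move=> r0 ds; apply: eE => // s /[dup] /ds dsg /andP[s0 _].
  by apply: (f_consts_inorm_le fc s0); exact: x_le.
have F_le r : 0 <= r -> inorm (d r) <= gamma1 ->
    inorm (Fr r - F r) <= Lf * inorm (d r).
  move=> r0 dr; apply: (f_consts_inorm_lip fc r0); last exact: x_le.
  by rewrite /Omega/=; have := xr_lt r r0; rewrite /rho; lra.
have GLf : 0 < 1 - L1norm (Gxm Am B kf) * Lf by rewrite subr_gt0.
have d_lt : forall r, 0 <= r -> inorm (d r) < gamma1.
  apply: lipschitz_barrier.
  - move=> b'; apply: (@vint_lipschitz _ _ d (fun r =>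
      (Am *m xr r + Bv *m v r + B *m (ur r + Fr r)) -
      (Am *m x r + Bv *m v r + B *m (ua r + F r))) 0).
      by apply: mxlocbmB; exact: oW.
    move=> r r0; rewrite vintB//; try exact: oW.
    by rewrite /d Exr// Ex// opprD addrACA subrr.
  - by rewrite /d Exr// Ex// !vintxx subrr inorm0 ltW.
  - move=> r r0 ds.
    (* Small-gain argument: [S] is finite since [ds] bounds it by [gamma1], and it satisfies
       [S <= q * S + y] with [q < 1] by (C2). Solving for [S] gives the left side of (C3). *)
    pose S := sup [set inorm (d s) | s in `[0, r]].
    have ubS : has_ubound [set inorm (d s) | s in `[0, r]].
      by exists gamma1 => _ [s /= + <-]; rewrite in_itv; exact: ds.
    have dS s : 0 <= s <= r -> inorm (d s) <= S.
      by move=> sr; apply: ub_le_sup => //; exists s => //=; rewrite in_itv.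
    have dB s : 0 <= s <= r -> inorm (d s) <=
        L1norm (Gxm Am B kf) * (Lf * S) + L1norm (HxmCBsAe Am B Ae kf) * g0.
      move=> /andP[s0 sr]; rewrite Wd// (le_trans (inormD _ _))//.
      apply: lerD; apply: L1norm_bound => //.
      + exact: mxlocbmB.
      + move=> y /andP[y0 ys]; have yr : 0 <= y <= r by rewrite y0 (le_trans ys).
        rewrite (le_trans (F_le y y0 (ds y yr)))//.
        by apply: ler_wpM2l => //; exact: dS.
      + move=> y /andP[y0 ys]; apply: e_le => // z /andP[z0 zy].
        by apply: ds; rewrite z0 (le_trans zy)// (le_trans ys).
    have SB : S <= L1norm (Gxm Am B kf) * (Lf * S) +
        L1norm (HxmCBsAe Am B Ae kf) * g0.
      apply: ge_sup.
        by exists (inorm (d 0)), 0 => //=; rewrite in_itv/= lexx.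
      by move=> _ [s /= + <-]; rewrite in_itv; exact: dB.
    apply: (le_lt_trans (dS r _)); first by rewrite r0 lexx.
    apply: le_lt_trans C3; rewrite mulrAC ler_pdivlMr//.
    move: SB; rewrite mulrA; set q := L1norm _ * Lf; set y := _ * g0; lra.
have d_le r : 0 <= r -> inorm (d r) <= gamma1 by move=> /d_lt /ltW.
have u_le r : 0 <= r -> inorm (ur r - ua r) <= gamma2.
  move=> r0; rewrite uE// addrC (le_trans (inormD _ _))// inormN.
  apply: lerD.
    rewrite -mulrA; apply: L1norm_bound => //; first exact: mxlocbmB.
    move=> s /andP[s0 _]; rewrite (le_trans (F_le s s0 (d_le s s0)))//.
    by apply: ler_wpM2l => //; exact: d_le.
  apply: L1norm_bound => // s /andP[s0 _].
  by apply: e_le => // y /andP[y0 _]; exact: d_le.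
split; first by move=> r r0; apply: x_le => //; exact: d_le.
split; last by [].
move=> r r0; have -> : ua r = ur r - (ur r - ua r) by rewrite subKr.
rewrite (le_trans (inormD _ _))// inormN; apply: lerD; last exact: u_le.
rewrite Eur// inormN; apply: L1norm_bound => // s /andP[s0 _].
by apply: (f_consts_inorm_le fcr s0); exact/ltW/xr_lt.
Qed.
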